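(* Consider the unconstrained linear time-varying (LTV) online control problem with prediction errors on disturbances described in the context, under the assumptions listed there. There exist constants $H_1\ge1$ and $\lambda_1\in(0,1)$, depending only on $\mu,\ell,d,\sigma,a,b,b',L_w$, which are perturbation constants for the problem in the sense of the context, such that whenever the prediction horizon satisfies $$k\ge\ln\left(\frac{4H_1^3L_g}{(1-\lambda_1)^2}\right)\Big/\ln(1/\lambda_1),$$ the dynamic regret of $\mathrm{MPC}_k$ with terminal cost $F_{t+k}(\cdot;\xi_{t+k\mid t})\equiv\mathbb{I}(\cdot;0)$ for $t<T-k$ is bounded by $$\mathrm{cost}(\mathrm{MPC}_k)-\mathrm{cost}(\mathrm{OPT})\le O\left(\sqrt{T\cdot\sum_{\tau=0}^{k-1}\lambda_1^\tau P(\tau)+\lambda_1^{2k}T^2}+\sum_{\tau=0}^{k-1}\lambda_1^\tau P(\tau)\right).$$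
   Context: Notation: $\|\cdot\|$ is the Euclidean norm for vectors and the spectral norm for matrices; $\alpha_{t_1:t_2}=(\alpha_{t_1},\dots,\alpha_{t_2})$. The constant hidden in $O(\cdot)$ depends only on the problem constants $\mu,\ell,d,\sigma,a,b,b',L_w,D_w,L_g,D_{x^*}$, not on $T$, $k$ or the prediction errors. Problem. Minimize $\sum_{t=0}^{T-1}(f_t^x(x_t)+f_t^u(u_t))+F_T(x_T)$ over states $x_{0:T}$ in $\mathbb{R}^n$ and actions $u_{0:T-1}$ in $\mathbb{R}^m$ subject to $x_{t+1}=A_tx_t+B_tu_t+w_t(\xi_t^* )$ for $0\le t<T$ and $x_0=x(0)$. The functions $w_t:\Xi_t\to\mathbb{R}^n$ are known; the true parameters $\xi_t^*\in\Xi_t$ are unknown to the controller. Each parameter space $\Xi_t$ has diameter at most $1$. $\mathrm{OPT}$ is the optimal trajectory (full knowledge of $\xi^*_{0:T}$), with states $x_t^*$; $\mathrm{cost}(\cdot)$ is the total cost of a controller's trajectory under the true parameters. Standing assumptions: $\|x_t^*\|\le D_{x^*}$ for all $t$; the dynamics are $L_g$-Lipschitz in $u_t$ (i.e. $\|B_t(u-u')\|\le L_g\|u-u'\|$). Assumptions: (1) $f_t^x,f_t^u,F_T$ are nonnegative, $\mu$-strongly convex and $\ell$-smooth, and $f_t^x(0)=f_t^u(0)=F_T(0)=0$. (2) $\|A_t\|\le a$, $\|B_t\|\le b$, $\|B_t^\dagger\|\le b'$ for all $t$ ($B_t^\dagger$ the Moore–Penrose inverse), and $\{A_t,B_t\}$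 is $\sigma$-uniformly controllable with controllability index $d$: with $\Phi(t_2,t_1)=A_{t_2-1}\cdots A_{t_1}$ for $t_2>t_1$ and $\Phi(t,t)=I$, and $M(t,p)=[\Phi(t+p,t+1)B_t,\Phi(t+p,t+2)B_{t+1},\dots,\Phi(t+p,t+p)B_{t+p-1}]\in\mathbb{R}^{n\times(mp)}$, $d$ is the smallest positive integer with $\sigma_{\min}(M(t,d))>0$ for all $t\in[0,T-d]$, and $\sigma_{\min}(M(t,d))\ge\sigma>0$ for all $t\in[0,T-d]$. (3) $\|w_t(\xi_t)\|\le D_w$ and $\|w_t(\xi_t)-w_t(\xi_t')\|\le L_w\|\xi_t-\xi_t'\|$ for all $\xi_t,\xi_t'\in\Xi_t$ and all $t$. Predictions. With prediction horizon $k$ ($1\le k\le T$), at time $t$ the controller receives $\xi_{\tau\mid t}\in\Xi_\tau$ for $t\le\tau\le\min\{t+k,T\}$. $\rho_{t,\tau}=\|\xi_{t+\tau\mid t}-\xi^*_{t+\tau}\|$ (and $0$ if $t+\tau>T$), $P(\tau)=\sum_{t=0}^{T-\tau}\rho_{t,\tau}^2$. FTOCP. $\psi_{t_1}^{t_2}(z,\xi_{t_1:t_2-1},\zeta_{t_2};F)$ denotes an optimal solution of: minimize $\sum_{t=t_1}^{t_2-1}(f_t^x(y_t)+f_t^u(v_t))+F(y_{t_2};\zeta_{t_2})$ subject to $y_{t+1}=A_ty_t+B_tv_t+w_t(\xi_t)$ for $t_1\le t<t_2$, $y_{t_1}=z$; the terminal parameter is also written $\xi_{t_2}$; subscripts $y_t,v_t$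 select entries. $\mathbb{I}(y;\zeta)=0$ if $y=\zeta$ and $+\infty$ otherwise. $\mathrm{MPC}_k$: at time $t$, with $t'=\min\{t+k,T\}$, apply $u_t=\psi_t^{t'}(x_t,\xi_{t:t'\mid t};F_{t'})_{v_t}$, with $F_{t'}$ the specified terminal cost if $t'<T$ and $F_T$ the true terminal cost if $t'=T$. Perturbation constants: $H_1,\lambda_1$ are such that, for all $k$ as in the claim, with $q_2(t)=q_3(t)=H_1\lambda_1^t$: (a) $\|\psi_{t_1}^{t_2}(z,\xi_{t_1:t_2};F)_{v_{t_1}}-\psi_{t_1}^{t_2}(z,\xi'_{t_1:t_2};F)_{v_{t_1}}\|\le\sum_{t=t_1}^{t_2}q_2(t-t_1)\|\xi_t-\xi_t'\|$ for every $z\in\mathbb{R}^n$, where $\xi_t\in\Xi_t$ and $\xi'_t=\xi^*_t$, both for $t_2=t_1+k$, $t_1<T-k$, $F=\mathbb{I}$ (with terminal parameters $\xi_{t_2},\xi_{t_2}'$ arbitrary in $\mathbb{R}^n$) and for $t_2=T$, $t_1\ge T-k$, $F=F_T$; (b) $\|\psi_{t_1}^T(z,\xi^*_{t_1:T};F_T)_{y_t/v_t}-\psi_{t_1}^T(z',\xi^*_{t_1:T};F_T)_{y_t/v_t}\|\le q_3(t-t_1)\|z-z'\|$ for all $t_1<T$, $t\in[t_1,T]$ and $z,z'\in\mathbb{R}^n$ (for both $y_t$ and, when $t<T$, $v_t$ entries). *)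

(* Defs.v *)
From mathcomp Require Import all_boot all_order all_algebra.
From mathcomp Require Import all_classical all_reals all_analysis.
Set Implicit Arguments.
Unset Strict Implicit.
Unset Printing Implicit Defensive.
Import Order.TTheory GRing.Theory Num.Theory.
Import numFieldNormedType.Exports.
Local Open Scope classical_set_scope.
Local Open Scope ring_scope.

(* The library norm on matrices is the max norm, hence the definitions below. *)
Definition enorm (R : realType) (n : nat) (x : 'cV[R]_n) : R :=
  Num.sqrt (\sum_i x i 0 ^+ 2).

Definition specnorm (R : realType) (p q : nat) (A : 'M[R]_(p, q)) : R :=
  sup [set enorm (A *m x) | x in [set x | enorm x <= 1]].

(* Smallest of the p singular values of A : R^q -> R^p, taken as the square
   roots of the eigenvalues of A A^T: it is positive iff A has full row rank.
   In particular it vanishes when 0 < p and q < p. *)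
Definition sigma_min (R : realType) (p q : nat) (A : 'M[R]_(p, q)) : R :=
  inf [set Num.sqrt l | l in [set l | eigenvalue (A *m A^T) l]].

Definition is_moore_penrose (R : realType) (p q : nat)
    (A : 'M[R]_(p, q)) (X : 'M[R]_(q, p)) : Prop :=
  [/\ A *m X *m A = A, X *m A *m X = X,
      (A *m X)^T = A *m X & (X *m A)^T = X *m A].

Definition moore_penrose (R : realType) (p q : nat) (A : 'M[R]_(p, q)) :
    'M[R]_(q, p) :=
  xget 0 [set X | is_moore_penrose A X].

Definition strongly_convex (R : realType) (n : nat) (mu : R)
    (f : 'cV[R]_n -> R) : Prop :=
  forall (x y : 'cV[R]_n) (s : R), 0 <= s <= 1 ->
    f (s *: x + (1 - s) *: y) <=
      s * f x + (1 - s) * f y - mu / 2 * (s * (1 - s)) * enorm (x - y) ^+ 2.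

Definition grad (R : realType) (n : nat) (f : 'cV[R]_n -> R) (x : 'cV[R]_n) :
    'cV[R]_n :=
  \col_i 'D_(delta_mx i 0) f x.

Definition smooth (R : realType) (n : nat) (ell : R) (f : 'cV[R]_n -> R) :
    Prop :=
  (forall x, differentiable f x) /\
  (forall x y, enorm (grad f x - grad f y) <= ell * enorm (x - y)).

(* Time-indexed data are total functions on nat; only t < horizon (and
   t <= horizon for the parameters) is ever constrained or used. *)
Record problem (R : realType) := Problem {
  horizon : nat;
  xdim : nat;
  udim : nat;
  pdim : nat -> nat;
  dynA : nat -> 'M[R]_xdim;
  dynB : nat -> 'M[R]_(xdim, udim);
  Xi : forall t, set 'cV[R]_(pdim t);
  wdist : forall t, 'cV[R]_(pdim t) -> 'cV[R]_xdim;
  xi_true : forall t, 'cV[R]_(pdim t);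
  costx : nat -> 'cV[R]_xdim -> R;
  costu : nat -> 'cV[R]_udim -> R;
  costT : 'cV[R]_xdim -> R;
  x_init : 'cV[R]_xdim
}.

Arguments dynA {R} p t.
Arguments dynB {R} p t.
Arguments costx {R} p t _.
Arguments costu {R} p t _.
Arguments costT {R} p _.
Arguments x_init {R} p.
Arguments Xi {R} p t _.
Arguments wdist {R} p t _.
Arguments xi_true {R} p t.

Definition params (R : realType) (P : problem R) : Type :=
  forall t, 'cV[R]_(pdim P t).

Definition traj (R : realType) (P : problem R) : Type :=
  ((nat -> 'cV[R]_(xdim P)) * (nat -> 'cV[R]_(udim P)))%type.

Definition well_formed_params (R : realType) (P : problem R) : Prop :=
  (forall t, (t <= horizon P)%N -> Xi P t (xi_true P t)) /\
  (forall t, (t <= horizon P)%N -> forall p q, Xi P t p -> Xi P t q ->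
     enorm (p - q) <= 1).

Definition admissible_cost (R : realType) (n : nat) (mu ell : R)
    (f : 'cV[R]_n -> R) : Prop :=
  [/\ forall x, 0 <= f x, strongly_convex mu f, smooth ell f & f 0 = 0].

Definition costs_assumption (R : realType) (mu ell : R) (P : problem R) :
    Prop :=
  [/\ forall t, (t < horizon P)%N -> admissible_cost mu ell (costx P t),
      forall t, (t < horizon P)%N -> admissible_cost mu ell (costu P t) &
      admissible_cost mu ell (costT P)].

(* A_{t2-1} ... A_{t1}, latest factor on the left *)
Definition transition (R : realType) (P : problem R) (t2 t1 : nat) :
    'M[R]_(xdim P) :=
  \big[mulmx/1%:M]_(s <- rev (index_iota t1 t2)) dynA P s.

Definition ctrl_matrix (R : realType) (P : problem R) (t p : nat) :
    'M[R]_(xdim P, \sum_(j < p) udim P) :=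
  \mxrow_(j < p) (transition P (t + p) (t + j).+1 *m dynB P (t + j)).

(* Index d presupposes that the range [0, T - d] is nonempty. *)
Definition ctrl_index (R : realType) (P : problem R) (d : nat) : Prop :=
  [/\ (0 < d <= horizon P)%N,
      forall t, (t + d <= horizon P)%N -> 0 < sigma_min (ctrl_matrix P t d) &
      forall p, (0 < p < d)%N ->
        ~ (forall t, (t + p <= horizon P)%N ->
             0 < sigma_min (ctrl_matrix P t p))].

Definition dynamics_assumption (R : realType) (a b b' sigma : R) (d : nat)
    (P : problem R) : Prop :=
  [/\ forall t, (t < horizon P)%N ->
        [/\ specnorm (dynA P t) <= a, specnorm (dynB P t) <= b &
            specnorm (moore_penrose (dynB P t)) <= b'],
      ctrl_index P d &
      forall t, (t + d <= horizon P)%N -> sigma <= sigma_min (ctrl_matrix P t d)].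

Definition disturbance_assumption (R : realType) (Dw Lw : R) (P : problem R) :
    Prop :=
  forall t, (t < horizon P)%N ->
    (forall p, Xi P t p -> enorm (wdist P t p) <= Dw) /\
    (forall p q, Xi P t p -> Xi P t q ->
       enorm (wdist P t p - wdist P t q) <= Lw * enorm (p - q)).

Definition lipschitz_in_action (R : realType) (Lg : R) (P : problem R) : Prop :=
  forall t, (t < horizon P)%N -> forall u u' : 'cV[R]_(udim P),
    enorm (dynB P t *m (u - u')) <= Lg * enorm (u - u').

(* The terminal cost F(.; zeta) is passed with zeta already applied.  Entries of
   a trajectory outside [t1, t2] (outside [t1, t2[ for actions) are irrelevant. *)
Definition ftocp_cost (R : realType) (P : problem R) (t1 t2 : nat)
    (F : 'cV[R]_(xdim P) -> \bar R) (s : traj P) : \bar R :=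
  ((\sum_(t1 <= t < t2) (costx P t (s.1 t) + costu P t (s.2 t)))%:E
   + F (s.1 t2))%E.

Definition feasible (R : realType) (P : problem R) (t1 t2 : nat)
    (z : 'cV[R]_(xdim P)) (xi : params P) (s : traj P) : Prop :=
  s.1 t1 = z /\
  forall t, (t1 <= t < t2)%N ->
    s.1 t.+1 = dynA P t *m s.1 t + dynB P t *m s.2 t + wdist P t (xi t).

Definition ftocp_opt (R : realType) (P : problem R) (t1 t2 : nat)
    (z : 'cV[R]_(xdim P)) (xi : params P) (F : 'cV[R]_(xdim P) -> \bar R)
    (s : traj P) : Prop :=
  [/\ feasible t1 t2 z xi s, (ftocp_cost t1 t2 F s < +oo)%E &
      forall s', feasible t1 t2 z xi s' ->
        (ftocp_cost t1 t2 F s <= ftocp_cost t1 t2 F s')%E].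

(* Strong convexity makes the optimum unique on the relevant entries.  The default
   trajectory is returned only if the problem has no optimal solution. *)
Definition psi (R : realType) (P : problem R) (t1 t2 : nat)
    (z : 'cV[R]_(xdim P)) (xi : params P) (F : 'cV[R]_(xdim P) -> \bar R) :
    traj P :=
  xget ((fun=> 0), (fun=> 0)) [set s : traj P | ftocp_opt t1 t2 z xi F s].

Definition indic_cost (R : realType) (n : nat) (zeta y : 'cV[R]_n) : \bar R :=
  if y == zeta then 0%E else +oo%E.

Definition final_cost (R : realType) (P : problem R) (y : 'cV[R]_(xdim P)) :
    \bar R :=
  (costT P y)%:E.

Definition total_cost (R : realType) (P : problem R) (s : traj P) : R :=
  \sum_(0 <= t < horizon P) (costx P t (s.1 t) + costu P t (s.2 t))
  + costT P (s.1 (horizon P)).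

Definition is_OPT (R : realType) (P : problem R) (s : traj P) : Prop :=
  ftocp_opt 0 (horizon P) (x_init P) (xi_true P) (final_cost (P := P)) s.

(* pred t tau is the prediction of xi_tau made at time t. *)
Definition admissible_pred (R : realType) (P : problem R) (k : nat)
    (pred : nat -> params P) : Prop :=
  forall t tau, (t <= horizon P)%N ->
    (t <= tau <= minn (t + k) (horizon P))%N -> Xi P tau (pred t tau).

Definition mpc_terminal (R : realType) (P : problem R) (k t : nat) :
    'cV[R]_(xdim P) -> \bar R :=
  if (t + k < horizon P)%N then indic_cost 0 else final_cost (P := P).

Definition mpc_action (R : realType) (P : problem R) (k : nat)
    (pred : nat -> params P) (t : nat) (x : 'cV[R]_(xdim P)) :
    'cV[R]_(udim P) :=
  (psi t (minn (t + k) (horizon P)) x (pred t) (mpc_terminal k t)).2 t.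

Fixpoint mpc_state (R : realType) (P : problem R) (k : nat)
    (pred : nat -> params P) (t : nat) : 'cV[R]_(xdim P) :=
  if t is s.+1 then
    let x := mpc_state k pred s in
    dynA P s *m x + dynB P s *m mpc_action k pred s x
      + wdist P s (xi_true P s)
  else x_init P.

Definition mpc_traj (R : realType) (P : problem R) (k : nat)
    (pred : nat -> params P) : traj P :=
  (mpc_state k pred, fun t => mpc_action k pred t (mpc_state k pred t)).

Definition pred_error (R : realType) (P : problem R) (pred : nat -> params P)
    (t tau : nat) : R :=
  if (t + tau <= horizon P)%N
  then enorm (pred t (t + tau)%N - xi_true P (t + tau)%N) else 0.

Definition pred_power (R : realType) (P : problem R) (pred : nat -> params P)
    (tau : nat) : R :=
  \sum_(0 <= t < (horizon P - tau).+1) pred_error pred t tau ^+ 2.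

(* First part: indicator terminal cost, with arbitrary terminal states zeta,
   zeta' as terminal parameters; second part: true terminal cost.  The terminal
   cost of the second part does not involve xi_T, whose term is kept anyway. *)
Definition perturbation_params (R : realType) (P : problem R) (q2 : nat -> R)
    (k : nat) : Prop :=
  (forall (t1 : nat) (z zeta zeta' : 'cV[R]_(xdim P)) (xi : params P),
     (t1 + k < horizon P)%N ->
     (forall t, (t1 <= t < t1 + k)%N -> Xi P t (xi t)) ->
     enorm ((psi t1 (t1 + k) z xi (indic_cost zeta)).2 t1
            - (psi t1 (t1 + k) z (xi_true P) (indic_cost zeta')).2 t1)
     <= \sum_(t1 <= t < t1 + k) q2 (t - t1)%N * enorm (xi t - xi_true P t)
        + q2 k * enorm (zeta - zeta')) /\
  (forall (t1 : nat) (z : 'cV[R]_(xdim P)) (xi : params P),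
     (horizon P - k <= t1 < horizon P)%N ->
     (forall t, (t1 <= t <= horizon P)%N -> Xi P t (xi t)) ->
     enorm ((psi t1 (horizon P) z xi (final_cost (P := P))).2 t1
            - (psi t1 (horizon P) z (xi_true P) (final_cost (P := P))).2 t1)
     <= \sum_(t1 <= t < (horizon P).+1)
          q2 (t - t1)%N * enorm (xi t - xi_true P t)).

Definition perturbation_init (R : realType) (P : problem R) (q3 : nat -> R) :
    Prop :=
  forall (t1 : nat) (z z' : 'cV[R]_(xdim P)), (t1 < horizon P)%N ->
    let s := psi t1 (horizon P) z (xi_true P) (final_cost (P := P)) in
    let s' := psi t1 (horizon P) z' (xi_true P) (final_cost (P := P)) in
    (forall t, (t1 <= t <= horizon P)%N ->
       enorm (s.1 t - s'.1 t) <= q3 (t - t1)%N * enorm (z - z')) /\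
    (forall t, (t1 <= t < horizon P)%N ->
       enorm (s.2 t - s'.2 t) <= q3 (t - t1)%N * enorm (z - z')).

Definition horizon_condition (R : realType) (H1 lambda1 Lg : R) (k : nat) :
    Prop :=
  ln (4 * H1 ^+ 3 * Lg / (1 - lambda1) ^+ 2) / ln lambda1^-1 <= k%:R.

(* Main.v *)
Require Import Defs.
From mathcomp Require Import all_boot all_order all_algebra.
From mathcomp Require Import all_classical all_reals all_analysis.
From mathcomp Require Import ring lra zify.
Set Implicit Arguments.
Unset Strict Implicit.
Unset Printing Implicit Defensive.
Import Order.TTheory GRing.Theory Num.Theory.
Import numFieldNormedType.Exports.
Local Open Scope classical_set_scope.
Local Open Scope ring_scope.

(** Throughout, a solution of a finite horizon problem is described by its costate
    [p]: the adjoint recursion [p t = grad f_t^x (y t) + A_t^T p (t + 1)] and the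
    stationarity equation [grad f_t^u (v t) + B_t^T p (t + 1) = 0] hold at every
    optimal trajectory ([kkt_final], and [kkt_indic] when the terminal state is
    prescribed).

    Exponential decay of perturbations. Subtract two such solutions and write
    [y, v, p] for the differences. The pairing [V t = dot (p t) (y t)] satisfies
    [V t - V (t + 1) >= mu (|y t|^2 + |v t|^2)] away from the times where the
    disturbances differ ([pairing_step]), because the gradients are strongly
    monotone. Conversely, uniform controllability lets one recover [p] from the
    action gradients over [d] steps, so that [|p j|^2] is bounded by a constant
    times the energy [|y t|^2 + |v t|^2] summed over times near [j]
    ([costate_near_final], [costate_near_fixed]). Hence [V] is itself dominated by
    the energy, and one may multiply the inequality by a slowly varying weight and
    sum: the variation of the weight only produces terms that the left side absorbs
    ([weighted_energy]). With the weights [r^t] and [r^-t], for [r < 1] close enough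
    to [1], this yields the two perturbation bounds with decay rate [sqrt r]
    ([decay_first_action], [decay_initial]).

    Regret. At each step compare the applied action with the first action of the
    optimal continuation from the current state; [action_error t] is their distance.
    An error at time [s] moves the next state by at most [Lg] times it, and its
    effect fades at the decay rate, so the distance to the optimal trajectory is a
    geometrically fading sum of past errors ([tracking]). The error itself is, by the
    first perturbation bound, at most the discounted prediction error, plus
    [lambda^k] times the norm of the state that the continuation reaches at the end
    of the prediction window, the controller aiming at [0] there
    ([action_error_le]). That norm involves the tracking error again; the lower
    bound on [k] closes this loop and bounds the sum of the squared errors
    ([action_error_sqr_sum]). Finally smoothness of the costs and boundedness of the
    optimal trajectory bound the regret by the sums of the distances and of their
    squares ([regret_le]). The optimal actions are bounded by the energy estimate
    against the zero trajectory ([opt_action_bounded]). *)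

(** * Euclidean inner product and norms *)

Section Euclid.
Context {R : realType}.
Implicit Types n m : nat.

Definition dot n (x y : 'cV[R]_n) : R := \sum_i x i 0 * y i 0.

Lemma dotC n (x y : 'cV[R]_n) : dot x y = dot y x.
Proof. by apply: eq_bigr => i _; rewrite mulrC. Qed.

Lemma dotDl n (x y z : 'cV[R]_n) : dot (x + y) z = dot x z + dot y z.
Proof. by rewrite -big_split; apply: eq_bigr => i _; rewrite mxE mulrDl. Qed.

Lemma dotZl n (c : R) (x y : 'cV[R]_n) : dot (c *: x) y = c * dot x y.
Proof. by rewrite mulr_sumr; apply: eq_bigr => i _; rewrite mxE mulrA. Qed.

Lemma dotNl n (x y : 'cV[R]_n) : dot (- x) y = - dot x y.
Proof. by rewrite -scaleN1r dotZl mulN1r. Qed.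

Lemma dotBl n (x y z : 'cV[R]_n) : dot (x - y) z = dot x z - dot y z.
Proof. by rewrite dotDl dotNl. Qed.

Lemma dotDr n (x y z : 'cV[R]_n) : dot x (y + z) = dot x y + dot x z.
Proof. by rewrite dotC dotDl !(dotC x). Qed.

Lemma dotZr n (c : R) (x y : 'cV[R]_n) : dot x (c *: y) = c * dot x y.
Proof. by rewrite dotC dotZl dotC. Qed.

Lemma dotNr n (x y : 'cV[R]_n) : dot x (- y) = - dot x y.
Proof. by rewrite dotC dotNl dotC. Qed.

Lemma dotBr n (x y z : 'cV[R]_n) : dot x (y - z) = dot x y - dot x z.
Proof. by rewrite dotDr dotNr. Qed.

Lemma dot0l n (x : 'cV[R]_n) : dot 0 x = 0.
Proof. by rewrite -(scale0r x) dotZl mul0r. Qed.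

Lemma dot0r n (x : 'cV[R]_n) : dot x 0 = 0.
Proof. by rewrite dotC dot0l. Qed.

Lemma dot_ge0 n (x : 'cV[R]_n) : 0 <= dot x x.
Proof. by apply: sumr_ge0 => i _; rewrite -expr2 sqr_ge0. Qed.

Lemma dot_eq0 n (x : 'cV[R]_n) : dot x x = 0 -> x = 0.
Proof.
move=> /eqP; rewrite psumr_eq0 => [/allP h|i _]; last by rewrite -expr2 sqr_ge0.
apply/matrixP => i j; rewrite ord1 mxE.
by have := h i (mem_index_enum i); rewrite /= mulf_eq0 orbb => /eqP.
Qed.

Lemma dot_inj n (x y : 'cV[R]_n) : (forall z, dot x z = dot y z) -> x = y.
Proof.
move=> h; apply/eqP; rewrite -subr_eq0; apply/eqP/dot_eq0.
by rewrite dotBl h subrr.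
Qed.

Lemma dot_mulmx n m (A : 'M[R]_(n, m)) x y : dot (A *m x) y = dot x (A^T *m y).
Proof.
have dotE k (u v : 'cV[R]_k) : dot u v = (u^T *m v) 0 0.
  by rewrite mxE; apply: eq_bigr => i _; rewrite mxE.
by rewrite !dotE trmx_mul mulmxA.
Qed.

Lemma enorm_ge0 n (x : 'cV[R]_n) : 0 <= enorm x.
Proof. exact: sqrtr_ge0. Qed.

Lemma enorm_sqr n (x : 'cV[R]_n) : enorm x ^+ 2 = dot x x.
Proof.
rewrite sqr_sqrtr; first by apply: eq_bigr => i _; rewrite expr2.
by apply: sumr_ge0 => i _; rewrite sqr_ge0.
Qed.

Lemma enorm0 n : enorm (0 : 'cV[R]_n) = 0.
Proof. by apply/eqP; rewrite -sqrf_eq0 enorm_sqr dot0l. Qed.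

Lemma enorm_eq0 n (x : 'cV[R]_n) : enorm x = 0 -> x = 0.
Proof. by move=> h; apply: dot_eq0; rewrite -enorm_sqr h expr0n. Qed.

Lemma ler_sqr_nneg (x y : R) : 0 <= y -> x ^+ 2 <= y ^+ 2 -> x <= y.
Proof. by move=> y0 h; nra. Qed.

Lemma dot_le_enorm n (x y : 'cV[R]_n) : dot x y <= enorm x * enorm y.
Proof.
have [y0|yN0] := eqVneq (dot y y) 0.
  by rewrite (dot_eq0 y0) dot0r mulr_ge0 ?enorm_ge0.
have ypos : 0 < dot y y by rewrite lt_neqAle eq_sym yN0 dot_ge0.
apply: ler_sqr_nneg; first by rewrite mulr_ge0 ?enorm_ge0.
rewrite exprMn !enorm_sqr.
have := dot_ge0 (dot y y *: x - dot x y *: y).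
rewrite dotBl !dotBr !dotZl !dotZr (dotC y x).
rewrite (_ : _ - _ = dot y y * (dot x x * dot y y - dot x y ^+ 2)); last by ring.
by rewrite pmulr_rge0 // subr_ge0.
Qed.

Lemma enormZ n (c : R) (x : 'cV[R]_n) : enorm (c *: x) = `|c| * enorm x.
Proof.
apply/eqP; rewrite -(@eqrXn2 _ 2) ?mulr_ge0 ?enorm_ge0 //.
by rewrite exprMn !enorm_sqr dotZl dotZr mulrA -expr2 real_normK ?num_real.
Qed.

Lemma enormN n (x : 'cV[R]_n) : enorm (- x) = enorm x.
Proof. by rewrite -scaleN1r enormZ normrN1 mul1r. Qed.

Lemma ler_enormD n (x y : 'cV[R]_n) : enorm (x + y) <= enorm x + enorm y.
Proof.
apply: ler_sqr_nneg; first by rewrite addr_ge0 ?enorm_ge0.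
rewrite sqrrD !enorm_sqr dotDl !dotDr (dotC y x).
by have := dot_le_enorm x y; lra.
Qed.

Lemma ler_enorm_dist n (x y z : 'cV[R]_n) :
  enorm (x - z) <= enorm (x - y) + enorm (y - z).
Proof. by rewrite -(subrKA y x) ler_enormD. Qed.

Lemma dot_ge_enorm n (x y : 'cV[R]_n) : - (enorm x * enorm y) <= dot x y.
Proof.
by have := dot_le_enorm (- x) y; rewrite dotNl enormN => h; rewrite lerNl.
Qed.

Lemma dot_young n (c : R) (x y : 'cV[R]_n) :
  0 < c -> dot x y <= c * dot x x + dot y y / (4 * c).
Proof.
move=> c0; have := dot_ge0 ((2 * c) *: x - y).
rewrite dotBl !dotBr !dotZl !dotZr (dotC y x) => h.
have -> : c * dot x x + dot y y / (4 * c) =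
  dot x y + (4 * c ^+ 2 * dot x x - 4 * c * dot x y + dot y y) / (4 * c).
  by field; rewrite gt_eqF.
rewrite lerDl; apply: divr_ge0; first by nra.
by rewrite mulr_ge0 // ltW.
Qed.

Lemma dotDD_le n (x y : 'cV[R]_n) :
  dot (x + y) (x + y) <= 2 * dot x x + 2 * dot y y.
Proof.
have := dot_ge0 (x - y).
rewrite dotBl !dotBr dotDl !dotDr (dotC y x); lra.
Qed.

Lemma enorm_le_sqr n (x : 'cV[R]_n) (c : R) :
  0 <= c -> (enorm x <= c) = (dot x x <= c ^+ 2).
Proof. by move=> c0; rewrite -enorm_sqr ler_pXn2r ?nnegrE ?enorm_ge0. Qed.

(** Finiteness of the supremum in [specnorm]: the Frobenius norm is a bound. *)
Lemma enorm_mulmx_bounded n m (A : 'M[R]_(n, m)) :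
  exists c : R, forall x, enorm (A *m x) <= c * enorm x.
Proof.
pose c := \sum_i dot (row i A)^T (row i A)^T.
have c0 : 0 <= c by apply: sumr_ge0 => i _; exact: dot_ge0.
exists (Num.sqrt c) => x.
rewrite enorm_le_sqr ?mulr_ge0 ?sqrtr_ge0 ?enorm_ge0 // exprMn sqr_sqrtr //.
rewrite mulr_suml; apply: ler_sum => i _.
have -> : (A *m x) i 0 = dot (row i A)^T x.
  by rewrite mxE; apply: eq_bigr => j _; rewrite !mxE.
rewrite -expr2 -enorm_sqr -exprMn -[leLHS]real_normK ?num_real //.
rewrite ler_pXn2r ?nnegrE ?mulr_ge0 ?enorm_ge0 // ler_norml.
by rewrite dot_ge_enorm dot_le_enorm.
Qed.

Lemma enorm_mulmx_specnorm n m (A : 'M[R]_(n, m)) x :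
  enorm (A *m x) <= specnorm A * enorm x.
Proof.
have [c hc] := enorm_mulmx_bounded A.
have [x0|xN0] := eqVneq (enorm x) 0.
  by rewrite (enorm_eq0 x0) mulmx0 !enorm0 mulr0.
have xpos : 0 < enorm x by rewrite lt_neqAle eq_sym xN0 enorm_ge0.
rewrite -ler_pdivrMr //.
have -> : enorm (A *m x) / enorm x = enorm (A *m ((enorm x)^-1 *: x)).
  by rewrite -scalemxAr enormZ gtr0_norm ?invr_gt0 // mulrC.
apply: ub_le_sup; last first.
  exists ((enorm x)^-1 *: x) => //=.
  by rewrite enormZ gtr0_norm ?invr_gt0 // mulVf.
exists `|c| => _ [y /= y1 <-]; apply: le_trans (hc y) _.
apply: le_trans (_ : `|c| * enorm y <= _); last by rewrite ler_piMr.
by rewrite ler_wpM2r ?enorm_ge0 ?ler_norm.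
Qed.

(** A matrix and its transpose have the same operator norm: test the bound on [A]
    at the vector [A^T *m x] itself. *)
Lemma dot_mulmx_le n m (A : 'M[R]_(n, m)) (c : R) : 0 <= c ->
  (forall x, enorm (A *m x) <= c * enorm x) ->
  forall x, dot (A^T *m x) (A^T *m x) <= c ^+ 2 * dot x x.
Proof.
move=> c0 hA x; set y := A^T *m x.
rewrite -!enorm_sqr -exprMn ler_pXn2r ?nnegrE ?mulr_ge0 ?enorm_ge0 //.
have [->|yN0] := eqVneq (enorm y) 0; first by rewrite mulr_ge0 ?enorm_ge0.
have ypos : 0 < enorm y by rewrite lt_neqAle eq_sym yN0 enorm_ge0.
rewrite -(ler_pM2r ypos) -expr2 enorm_sqr {1}/y -[A in A^T]trmxK.
rewrite trmxK dotC -dot_mulmx.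
apply: le_trans (dot_le_enorm _ _) _.
by rewrite mulrAC ler_wpM2r ?enorm_ge0.
Qed.

(** Every first-order condition below comes from this remark: the value is never
    below the one at [s = 0], and the step [s = - l / k] with [k] large makes the
    linear term dominate. *)
Lemma linear_part_eq0 (l q : R) :
  (forall s : R, `|s| <= 1 -> 0 <= s * l + s ^+ 2 * q) -> l = 0.
Proof.
move=> h; apply/eqP/negPn/negP => lN0.
pose k := 1 + `|q| + `|l|.
have k0 : 0 < k by rewrite /k; have := normr_ge0 q; have := normr_ge0 l; lra.
have hs : `|- l / k| <= 1.
  rewrite normrM normrN normfV (gtr0_norm k0) ler_pdivrMr // mul1r /k.
  by have := normr_ge0 q; lra.
have := h _ hs.
have -> : - l / k * l + (- l / k) ^+ 2 * q = l ^+ 2 / k ^+ 2 * (q - k).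
  by field; rewrite gt_eqF.
have l2 : 0 < l ^+ 2 / k ^+ 2
  by apply: divr_gt0; rewrite exprn_even_gt0 //= gt_eqF.
rewrite pmulr_rge0 // /k; have := ler_norm q; have : 0 < `|l| by rewrite normr_gt0.
by lra.
Qed.

End Euclid.


(** * Gradient inequalities for strongly convex smooth costs *)

Section Costs.
Context {R : realType} (n : nat).
Implicit Types (f : 'cV[R]_n -> R) (x y h : 'cV[R]_n).

Lemma derive_grad f x h : differentiable f x -> 'D_h f x = dot (grad f x) h.
Proof.
move=> df; rewrite deriveE //.
have {1}-> : h = \sum_i h i 0 *: delta_mx i 0.
  rewrite {1}(matrix_sum_delta h); apply: eq_bigr => i _.
  by rewrite big_ord1.
rewrite linear_sum; apply: eq_bigr => i _.
by rewrite linearZ /= mxE deriveE // mulrC.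
Qed.

Lemma is_derive_line f x h (s : R) : differentiable f (x + s *: h) ->
  is_derive s 1 (fun r : R => f (x + r *: h)) (dot (grad f (x + s *: h)) h).
Proof.
move=> df; rewrite -derive_grad //.
have quotE : (fun k : R => k^-1 *: (((fun r : R => f (x + r *: h)) \o shift s)
      (k *: (1 : R)) - f (x + s *: h))) =
    (fun k : R => k^-1 *: ((f \o shift (x + s *: h)) (k *: h) - f (x + s *: h))).
  apply/funext => k /=; congr (_ *: (f _ - _)).
  by rewrite [k *: 1]mulr1 scalerDl addrCA addrA.
apply: DeriveDef; rewrite /derivable /derive quotE //.
exact: (diff_derivable df : derivable f (x + s *: h) h).
Qed.

Section Smooth.
Variables (mu ell L : R) (f : 'cV[R]_n -> R).
Hypotheses (mu_gt0 : 0 < mu) (L_ge0 : 0 <= L) (ell_le : ell <= L).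
Hypothesis f_cost : admissible_cost mu ell f.

Lemma cost_grad_lipschitz x y :
  enorm (grad f x - grad f y) <= L * enorm (x - y).
Proof.
case: f_cost => _ _ [_ /(_ x y) h] _; apply: le_trans h _.
by rewrite ler_wpM2r ?enorm_ge0.
Qed.

Lemma cost_continuous : continuous f.
Proof.
case: f_cost => _ _ [df _] _ x; exact: differentiable_continuous (df x).
Qed.

(** By the mean value theorem the increment of [f] is its slope along [h] at an
    intermediate point, and the gradient has moved by at most [L * enorm h]
    there. *)
Lemma cost_taylor x h : `|f (x + h) - f x - dot (grad f x) h| <= L * dot h h.
Proof.
have [_ _ [df _] _] := f_cost.
have dline (s : R) := @is_derive_line f x h s (df _).
have cline : continuous (fun r : R => f (x + r *: h)).
  move=> r; apply/differentiable_continuous/derivable1_diffP.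
  exact: (@ex_derive _ _ _ _ _ _ _ (dline r)).
have [c] := MVT_segment (@ler01 R) (fun s _ => dline s)
  (continuous_subspaceT cline).
rewrite in_itv /= => /andP[c0 c1].
rewrite scale1r scale0r addr0 subr0 mulr1 => ->; rewrite -dotBl.
have hg : enorm (grad f (x + c *: h) - grad f x) <= L * enorm h.
  apply: le_trans (cost_grad_lipschitz _ _) _.
  rewrite addrC addKr enormZ ger0_norm // ler_wpM2l //.
  by rewrite ler_piMl ?enorm_ge0.
rewrite -enorm_sqr expr2 mulrA ler_norml.
have := dot_ge_enorm (grad f (x + c *: h) - grad f x) h.
have := dot_le_enorm (grad f (x + c *: h) - grad f x) h.
have := ler_wpM2r (enorm_ge0 h) hg.
by lra.
Qed.

Lemma cost_grad0 : grad f 0 = 0.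
Proof.
have [fge0 _ _ f0] := f_cost; apply: dot_inj => h; rewrite dot0l.
apply: (@linear_part_eq0 _ _ (L * dot h h)) => s _.
have := cost_taylor 0 (s *: h); rewrite add0r f0 subr0 dotZr !dotZl dotZr.
rewrite ler_norml => /andP[_]; have := fge0 (s *: h); nra.
Qed.

(** Compare strong convexity at [x + s *: (y - x)] with the Taylor bound there:
    after division by [s] the two differ by a multiple of [s]. *)
Lemma cost_gradient_ineq x y :
  f x + dot (grad f x) (y - x) + mu / 2 * dot (y - x) (y - x) <= f y.
Proof.
have [_ fsc _ _] := f_cost.
set h := y - x; set q := L * dot h h + mu / 2 * dot h h.
have q0 : 0 <= q by rewrite addr_ge0 // mulr_ge0 ?dot_ge0 ?divr_ge0 // ltW.
rewrite leNgt; apply/negP => lt_fy.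
pose g := f x + dot (grad f x) h + mu / 2 * dot h h - f y.
have g0 : 0 < g by rewrite subr_gt0.
(* [q] bounds all second-order terms; this [s] makes [s * q] smaller than the
   gap [g] between the two sides. *)
pose s := g / (g + q + 1).
have gq0 : 0 < g + q + 1 by lra.
have s0 : 0 < s by rewrite divr_gt0.
have s1 : s <= 1 by rewrite ler_pdivrMr //; lra.
have := fsc y x s; rewrite ltW //= => /(_ s1).
have -> : s *: y + (1 - s) *: x = x + s *: h.
  by rewrite scalerBl scale1r scalerBr addrCA.
rewrite enorm_sqr -/h.
have := cost_taylor x (s *: h); rewrite dotZr !dotZl dotZr ler_norml.
move=> /andP[taylor _] sc.
have : s * g <= s * (s * q) by rewrite /g /q; nra.
rewrite ler_pM2l // /s mulrAC ler_pdivlMr //.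
by nra.
Qed.

Lemma cost_grad_monotone x y :
  mu * dot (x - y) (x - y) <= dot (grad f x - grad f y) (x - y).
Proof.
have := cost_gradient_ineq x y; have := cost_gradient_ineq y x.
rewrite -(opprB x y) !(dotNr, dotNl) opprK (dotBl (grad f x)); lra.
Qed.

Lemma cost_lower x : mu / 2 * dot x x <= f x.
Proof.
have [_ _ _ f0] := f_cost; have := cost_gradient_ineq 0 x.
by rewrite f0 cost_grad0 subr0 dot0l !add0r.
Qed.

Lemma cost_diff_le x y (D : R) : enorm y <= D ->
  f x - f y <= L * D * enorm (x - y) + L * enorm (x - y) ^+ 2.
Proof.
move=> yD; have := cost_taylor y (x - y); rewrite subrKC enorm_sqr.
rewrite ler_norml => /andP[_ taylor].
have gy : enorm (grad f y) <= L * D.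
  have := cost_grad_lipschitz y 0; rewrite cost_grad0 !subr0 => h.
  by apply: le_trans h _; rewrite ler_wpM2l.
have := dot_le_enorm (grad f y) (x - y).
by have := ler_wpM2r (enorm_ge0 (x - y)) gy; lra.
Qed.

End Smooth.
End Costs.


(** * Existence of minimizers and the least singular value *)

Section Minimizers.
Context {R : realType}.

(** The constraint is the zero set of a continuous function so that one statement
    covers a free terminal state ([g = 0]), a prescribed one, and the unit
    sphere. *)
Lemma coercive_argmin n (f g : 'rV[R]_n -> R) (c : R) (U0 : 'rV[R]_n) :
  0 < c -> continuous f -> continuous g ->
  (forall U, c * dot U^T U^T <= f U) -> g U0 = 0 ->
  exists2 U, g U = 0 & forall V, g V = 0 -> f U <= f V.
Proof.
move=> c0 cf cg coerc gU0.
pose K := (g @^-1` [set x | x = 0]) `&` (f @^-1` [set x | x <= f U0]).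
have Kcl : closed K.
  apply: closedI.
    by apply: closed_comp => [x _|]; [exact: cg | exact: closed_eq].
  by apply: closed_comp => [x _|]; [exact: cf | exact: closed_le].
have Kbd : bounded_set K.
  exists (f U0 / c + 1); split; first exact: num_real.
  move=> M ltM U [_ /= fU]; apply: le_trans (ltW ltM).
  have Uf : dot U^T U^T <= f U0 / c.
    by rewrite ler_pdivlMr // mulrC; apply: le_trans fU.
  rewrite [leLHS]/Num.Def.normr /= mx_normrE; apply: bigmax_le.
    by apply: addr_ge0 => //; apply: le_trans Uf; exact: dot_ge0.
  move=> [i j] _ /=; rewrite ord1.
  have Uj : U 0 j ^+ 2 <= dot U^T U^T.
    rewrite /dot (bigD1 j) //= mxE -expr2 lerDl; apply: sumr_ge0 => k _.
    by rewrite -expr2 sqr_ge0.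
  rewrite -real_normK ?num_real // in Uj; nra.
have Kco := bounded_closed_compact Kbd Kcl.
have K0 : K !=set0 by exists U0; split => /=.
have [U /set_mem [gU fU] Umin] := compact_EVT_min K0 Kco (continuous_subspaceT cf).
exists U => // V gV; have [fV|/ltW fV] := leP (f V) (f U0).
  by apply: Umin; apply/mem_set; split.
exact: le_trans fU fV.
Qed.

Lemma continuous_dot n m (y z : 'rV[R]_n -> 'cV[R]_m) :
  (forall i, continuous (fun U => y U i 0)) ->
  (forall i, continuous (fun U => z U i 0)) ->
  continuous (fun U => dot (y U) (z U)).
Proof.
move=> cy cz; apply: continuous_big => [x|i _ U]; first exact: add_continuous.
exact: (continuousM (cy i U) (cz i U)).
Qed.

(** The Rayleigh quotient of [M *m M^T] attains its minimum on the unit sphere,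
    and the minimum is an eigenvalue; so the infimum over the eigenvalues is a
    lower bound of the quotient. *)
Lemma sigma_min_coercive n m (M : 'M[R]_(n, m)) (sigma : R) : 0 <= sigma ->
  sigma <= sigma_min M ->
  forall p : 'cV[R]_n, sigma ^+ 2 * dot p p <= dot (M^T *m p) (M^T *m p).
Proof.
move=> sigma0 sM p.
have [p0|pN0] := eqVneq (dot p p) 0.
  by rewrite p0 mulr0 dot_ge0.
have cid i : continuous (fun U : 'rV[R]_n => U^T i 0).
  by under eq_fun do rewrite mxE; exact: coord_continuous.
have cM i : continuous (fun U : 'rV[R]_n => (M^T *m U^T) i 0).
  under eq_fun do rewrite mxE.
  apply: continuous_big => [x|j _ U]; first exact: add_continuous.
  apply: continuousM; [exact: cst_continuous | exact: cid].
pose q (x : 'cV[R]_n) := dot (M^T *m x) (M^T *m x).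
(* The squared norm is constant on the sphere; adding it makes the function
   coercive on the whole space. *)
pose f (U : 'rV[R]_n) := q U^T + dot U^T U^T.
pose g (U : 'rV[R]_n) := dot U^T U^T - 1.
have cd : continuous (fun U : 'rV[R]_n => dot U^T U^T) by exact: continuous_dot.
have cq : continuous (fun U : 'rV[R]_n => q U^T) by exact: continuous_dot.
have cf : continuous f.
  move=> U.
  exact: (continuousD (cq U) (cd U)).
have cg : continuous g.
  move=> U; apply: (continuousB (cd U)).
  exact: cst_continuous.
pose U0 := ((enorm p)^-1 *: p)^T.
have ep0 : enorm p != 0 by rewrite -sqrf_eq0 enorm_sqr.
have gZ (x : 'cV[R]_n) : enorm x != 0 -> g ((enorm x)^-1 *: x)^T = 0.
  move=> xN0; rewrite /g trmxK dotZl dotZr -enorm_sqr mulrA -expr2 -exprMn.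
  by rewrite mulVf // expr1n subrr.
have coerc U : 1 * dot U^T U^T <= f U by rewrite mul1r lerDr dot_ge0.
have [U gU Umin] := coercive_argmin ltr01 cf cg coerc (gZ p ep0).
pose x := U^T; pose l := q x.
have x1 : dot x x = 1 by apply/eqP; rewrite -subr_eq0 -/(g U) gU.
have qZ c (y : 'cV[R]_n) : q (c *: y) = c ^+ 2 * q y.
  by rewrite /q -scalemxAr dotZl dotZr mulrA expr2.
have lmin (y : 'cV[R]_n) : l * dot y y <= q y.
  have [y0|yN0] := eqVneq (enorm y) 0.
    by rewrite -enorm_sqr y0 expr0n mulr0 dot_ge0.
  have := Umin _ (gZ y yN0).
  have /eqP := gZ y yN0; have /eqP := gU; rewrite /g !subr_eq0 /f.
  move=> /eqP -> /eqP ->; rewrite lerD2r trmxK qZ -/x -/l => h.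
  rewrite -enorm_sqr -ler_pdivlMr ?exprn_even_gt0 //= mulrC -exprVn.
  exact: h.
have eig : M *m M^T *m x = l *: x.
  apply: dot_inj => h; apply/eqP; rewrite -subr_eq0; apply/eqP.
  apply: (@linear_part_eq0 _ _ (2^-1 * (q h - l * dot h h))) => s _.
  have := lmin (x + s *: h).
  rewrite /q mulmxDr -scalemxAr !(dotDl, dotDr, dotZl, dotZr).
  rewrite -/(q h) -/(q x) -/l x1 (dotC h x) (dotC (M^T *m h)).
  have -> : dot (M^T *m x) (M^T *m h) = dot (M *m M^T *m x) h.
    by rewrite -mulmxA [RHS]dot_mulmx.
  by nra.
have evl : eigenvalue (M *m M^T) l.
  apply/eigenvalueP; exists x^T.
    apply: trmx_inj; rewrite !trmx_mul !linearZ /= !trmxK; exact: eig.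
  by apply/eqP => xT0; move: x1; rewrite -[x]trmxK xT0 trmx0 dot0l => /eqP;
    rewrite eq_sym oner_eq0.
have sl : sigma <= Num.sqrt l.
  apply: le_trans sM _; apply: ge_inf; last by exists l.
  by exists 0 => _ [z _ <-]; exact: sqrtr_ge0.
have l0 : 0 <= l by exact: dot_ge0.
apply: le_trans (lmin p); rewrite ler_wpM2r ?dot_ge0 //.
by rewrite -(sqr_sqrtr l0) ler_pXn2r ?nnegrE ?sqrtr_ge0.
Qed.

Lemma sigma_min_gt0_xdim n m (M : 'M[R]_(n, m)) : 0 < sigma_min M -> (0 < n)%N.
Proof.
case: n M => // M; rewrite /sigma_min.
rewrite (_ : [set _ | _ in _] = set0) ?inf0 ?ltxx //.
apply/seteqP; split => // x [l /= /eigenvalueP [v _ vN0] _].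
by move: vN0; rewrite [v]thinmx0 eqxx.
Qed.

End Minimizers.


(** * Rollouts of the linear dynamics and steering *)

Section Dynamics.
Context {R : realType} (P : problem R).
Local Notation A := (dynA P).
Local Notation B := (dynB P).
Local Notation stateT := 'cV[R]_(xdim P).
Local Notation actionT := 'cV[R]_(udim P).

Fixpoint rollout_steps (t1 : nat) (z : stateT) (w : nat -> stateT)
    (v : nat -> actionT) (j : nat) : stateT :=
  if j is i.+1 then
    A (t1 + i)%N *m rollout_steps t1 z w v i + B (t1 + i)%N *m v (t1 + i)%N
      + w (t1 + i)%N
  else z.

Definition rollout t1 z w v (t : nat) : stateT :=
  rollout_steps t1 z w v (t - t1)%N.

Lemma rollout_init t1 z w v : rollout t1 z w v t1 = z.
Proof. by rewrite /rollout subnn. Qed.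

Lemma rolloutS t1 z w v t : (t1 <= t)%N ->
  rollout t1 z w v t.+1 = A t *m rollout t1 z w v t + B t *m v t + w t.
Proof. by move=> h; rewrite /rollout subSn //= subnKC. Qed.

Lemma rollout_unique t1 t2 z w v (y : nat -> stateT) :
  y t1 = z ->
  (forall t, (t1 <= t < t2)%N -> y t.+1 = A t *m y t + B t *m v t + w t) ->
  forall t, (t1 <= t <= t2)%N -> y t = rollout t1 z w v t.
Proof.
move=> yz yS; elim=> [|t ih] /andP[h1 h2].
  by move: yz; have -> : t1 = 0%N by [lia]; rewrite rollout_init.
move: h1; rewrite leq_eqVlt => /predU1P[h1|h1].
  by rewrite -h1 rollout_init.
by rewrite rolloutS // yS ?ih //; lia.
Qed.

Lemma rolloutDZ t1 z w v v' s t : (t1 <= t)%N ->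
  rollout t1 z w (fun t => v t + s *: v' t) t
  = rollout t1 z w v t + s *: rollout t1 0 (fun=> 0) v' t.
Proof.
elim: t => [|t ih] h.
  by move: h; rewrite leqn0 => /eqP ->; rewrite !rollout_init scaler0 addr0.
move: h; rewrite leq_eqVlt => /predU1P[<-|h].
  by rewrite !rollout_init scaler0 addr0.
rewrite !rolloutS // ih // !mulmxDr addr0 -!scalemxAr scalerDr.
by rewrite addrACA [LHS]addrAC.
Qed.

Lemma transition_id t : transition P t t = 1%:M.
Proof. by rewrite /transition /index_iota subnn big_nil. Qed.

Lemma transitionS t2 t1 : (t1 <= t2)%N ->
  transition P t2.+1 t1 = A t2 *m transition P t2 t1.
Proof.
move=> h; rewrite /transition /index_iota subSn // -addn1 iotaD subnKC //.
by rewrite rev_cat big_cons.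
Qed.

Lemma transition_split t2 t1 : (t1 < t2)%N ->
  transition P t2 t1 = transition P t2 t1.+1 *m A t1.
Proof.
elim: t2 => // t2 ih; rewrite ltnS leq_eqVlt => /predU1P[->|h].
  by rewrite transitionS // !transition_id mulmx1 mul1mx.
by rewrite (transitionS (ltnW h)) ih // transitionS // mulmxA.
Qed.

Lemma rollout_ctrl t1 N v :
  rollout t1 0 (fun=> 0) v (t1 + N)
  = ctrl_matrix P t1 N *m \mxcol_(j < N) v (t1 + j)%N.
Proof.
rewrite mul_mxrow_mxcol; elim: N => [|N ih].
  by rewrite addn0 rollout_init big_ord0.
rewrite addnS rolloutS ?leq_addr // ih big_ord_recr /= addr0 transition_id.
rewrite mul1mx; congr (_ + _).
rewrite mulmx_sumr; apply: eq_bigr => j _ /=.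
by rewrite transitionS ?mulmxA // ltn_add2l.
Qed.

Lemma rollout_affine t1 z w v t : (t1 <= t)%N ->
  rollout t1 z w v t = rollout t1 z w (fun=> 0) t + rollout t1 0 (fun=> 0) v t.
Proof.
move=> h; have := rolloutDZ z w (fun=> 0) v 1 h.
by rewrite scale1r => <-; congr (rollout _ _ _ _ _); apply/funext => s;
  rewrite add0r scale1r.
Qed.

Section Controllable.
Variables (d : nat).
Hypothesis d_ctrl : forall t, (t + d <= horizon P)%N ->
  0 < sigma_min (ctrl_matrix P t d).

(** A longer horizon keeps the last window of length [d] among its blocks. *)
Lemma ctrl_matrix_row_free t1 N : (d <= N)%N -> (t1 + N <= horizon P)%N ->
  row_free (ctrl_matrix P t1 N).
Proof.
move=> dN hN; apply: inj_row_free => u uM; pose t := (t1 + N - d)%N.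
have uj (j : 'I_N) : u *m (transition P (t1 + N) (t1 + j).+1 *m B (t1 + j)%N) = 0.
  move: uM; rewrite /ctrl_matrix mul_mxrow => /mxrowP /(_ j).
  by rewrite mxrowK submxrow0.
have tN : (t + d = t1 + N)%N by rewrite /t; lia.
have hM : u *m ctrl_matrix P t d = 0.
  rewrite /ctrl_matrix mul_mxrow -[RHS]mxrow0; apply: eq_mxrow => j.
  have hj : (N - d + j < N)%N by have := ltn_ord j; lia.
  have := uj (Ordinal hj) => /=.
  by rewrite tN; have -> : (t1 + (N - d + j) = t + j)%N by rewrite /t; lia.
have s0 : 0 < sigma_min (ctrl_matrix P t d) by apply: d_ctrl; rewrite tN.
have := sigma_min_coercive (ltW s0) (lexx _) u^T.
rewrite -trmx_mul hM trmx0 dot0l pmulr_rle0 ?exprn_gt0 // => h.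
apply: trmx_inj; rewrite trmx0; apply: dot_eq0; apply/eqP.
by rewrite eq_le h dot_ge0.
Qed.

Lemma steering t1 N z w zeta : (d <= N)%N -> (t1 + N <= horizon P)%N ->
  exists v, rollout t1 z w v (t1 + N) = zeta.
Proof.
move=> dN hN; have /row_freeP[X MX] := ctrl_matrix_row_free dN hN.
pose x := X *m (zeta - rollout t1 z w (fun=> 0) (t1 + N)).
pose v t : actionT := if insub (t - t1)%N is Some j
  then @submxcol _ N (fun=> udim P) _ x j else 0.
exists v; rewrite rollout_affine ?leq_addr // rollout_ctrl.
have -> : \mxcol_(j < N) v (t1 + j)%N = x.
  rewrite -[RHS]submxcolK; apply: eq_mxcol => j.
  by rewrite /v addKn valK.
by rewrite mulmxA MX mul1mx subrKC.
Qed.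

End Controllable.
End Dynamics.


(** * Existence of optimal trajectories *)

Lemma continuous_cV (R : realType) n m (y : 'rV[R]_n -> 'cV[R]_m) :
  (forall i, continuous (fun U => y U i 0)) -> continuous y.
Proof.
move=> cy U S [I I_nbhs IS].
have FU : Filter (nbhs U) by exact: nbhs_filter.
suff h : nbhs U [set V | forall i j, I i j (y V i j)].
  by apply: (@filterS _ (nbhs U) FU _ _ _ h) => V; exact: IS.
apply: (@filter_forall _ _ _ _ FU) => i.
apply: (@filter_forall _ _ _ _ FU) => j.
by rewrite ord1; exact: (cy i U _ (I_nbhs i 0)).
Qed.

Lemma sum_nat_shift (V : nmodType) t1 N (F : nat -> V) :
  \sum_(t1 <= t < t1 + N) F t = \sum_(j < N) F (t1 + j)%N.
Proof.
rewrite -[X in \sum_(X <= _ < _) _]add0n big_addn addKn big_mkord.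
by apply: eq_bigr => j _; rewrite addnC.
Qed.

Section Optimality.
Context {R : realType} (P : problem R).
Local Notation A := (dynA P).
Local Notation B := (dynB P).
Local Notation T := (horizon P).
Local Notation stateT := 'cV[R]_(xdim P).
Local Notation actionT := 'cV[R]_(udim P).
Variables (mu ell L : R).
Hypotheses (mu_gt0 : 0 < mu) (L_ge0 : 0 <= L) (ell_le : ell <= L).
Hypothesis costs : costs_assumption mu ell P.

Definition stage_cost (t1 t2 : nat) (y : nat -> stateT) (v : nat -> actionT) : R :=
  \sum_(t1 <= t < t2) (costx P t (y t) + costu P t (v t)).

Lemma stage_cost_ge t1 t2 y v : (t2 <= T)%N ->
  \sum_(t1 <= t < t2) mu / 2 * dot (v t) (v t) <= stage_cost t1 t2 y v.
Proof.
have [cx cu _] := costs; move=> h.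
apply: ler_sum_nat => t /andP[_ tt2].
have tT : (t < T)%N by apply: leq_trans h.
have := cost_lower mu_gt0 L_ge0 ell_le (cu t tT) (v t).
by have [x0 _ _ _] := cx t tT; have := x0 (y t); lra.
Qed.

Section Existence.
Variables (t1 N : nat) (z : stateT) (w : nat -> stateT).
Hypothesis (hN : (t1 + N <= T)%N).

(** The actions at the [N] times of the horizon are packed in one vector so that
    [coercive_argmin] applies. *)
Definition decode (U : 'rV[R]_(N * udim P)) (t : nat) : actionT :=
  if insub (t - t1)%N is Some j then \col_k U 0 (mxvec_index j k) else 0.

Definition encode (v : nat -> actionT) : 'rV[R]_(N * udim P) :=
  mxvec (\matrix_(j < N, k < udim P) v (t1 + j)%N k 0).

Lemma encodeK v t : (t1 <= t < t1 + N)%N -> decode (encode v) t = v t.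
Proof.
move=> /andP[h1 h2]; have h : (t - t1 < N)%N by lia.
rewrite /decode insubT; apply/colP => k.
by rewrite !mxE mxvecE mxE /= subnKC.
Qed.

Lemma dot_decode (U : 'rV[R]_(N * udim P)) :
  dot U^T U^T = \sum_(t1 <= t < t1 + N) dot (decode U t) (decode U t).
Proof.
rewrite /dot (reindex _ (curry_mxvec_bij _ _)) /=.
rewrite sum_nat_shift.
rewrite pair_bigA; apply: eq_bigr => -[j k] _ /=.
by rewrite /decode addKn valK !mxE.
Qed.

Lemma continuous_decode t k : continuous (fun U => decode U t k 0).
Proof.
rewrite /decode; case: insubP => [j _ _|_].
  by under eq_fun do rewrite mxE; exact: coord_continuous.
by under eq_fun do rewrite mxE; move=> U; exact: cst_continuous.
Qed.

Lemma continuous_rollout t i : (t1 <= t)%N ->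
  continuous (fun U => rollout t1 z w (decode U) t i 0).
Proof.
have contM n m (M : 'M[R]_(n, m)) (y : 'rV[R]_(N * udim P) -> 'cV[R]_m) i0 :
    (forall i, continuous (fun U => y U i 0)) ->
    continuous (fun U => (M *m y U) i0 0).
  move=> cy; under eq_fun do rewrite mxE.
  apply: continuous_big => [x|j _ U]; first exact: add_continuous.
  by apply: continuousM; [exact: cst_continuous | exact: cy].
move=> h; rewrite -(subnKC h); elim: (t - t1)%N i => [|j ih] i.
  by rewrite addn0; under eq_fun do rewrite rollout_init; move=> U;
    exact: cst_continuous.
rewrite addnS.
have -> : (fun U => rollout t1 z w (decode U) (t1 + j).+1 i 0) =
    (fun U => (A (t1 + j)%N *m rollout t1 z w (decode U) (t1 + j)) i 0
       + (B (t1 + j)%N *m decode U (t1 + j)%N) i 0 + w (t1 + j)%N i 0).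
  by apply/funext => U; rewrite rolloutS ?leq_addr // !mxE.
have cA := @contM _ _ (A (t1 + j)%N) _ i ih.
have cB := @contM _ _ (B (t1 + j)%N) _ i (@continuous_decode (t1 + j)%N).
move=> U; apply: (continuousD (continuousD (cA U) (cB U))).
exact: cst_continuous.
Qed.

(** Rollouts depend continuously on the finitely many action coordinates and
    the stage costs are coercive in them; [C] encodes the terminal constraint. *)
Lemma optimal_actions_exist (G C : stateT -> R) (v0 : nat -> actionT) :
  continuous G -> continuous C -> (forall y, 0 <= G y) ->
  C (rollout t1 z w v0 (t1 + N)) = 0 ->
  let J v := stage_cost t1 (t1 + N) (rollout t1 z w v) v
             + G (rollout t1 z w v (t1 + N)) in
  exists2 v, C (rollout t1 z w v (t1 + N)) = 0 &
    forall v', C (rollout t1 z w v' (t1 + N)) = 0 -> J v <= J v'.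
Proof.
move=> cG cC G0 Cv0 J; have [cx cu _] := costs.
have roll_code v t : (t1 <= t <= t1 + N)%N ->
    rollout t1 z w (decode (encode v)) t = rollout t1 z w v t.
  move=> ht; symmetry; apply: (@rollout_unique _ _ t1 (t1 + N)%N) => //.
    by rewrite rollout_init.
  by move=> s hs; rewrite rolloutS ?encodeK //; case/andP: hs.
have J_code v : J (decode (encode v)) = J v.
  rewrite /J roll_code ?leq_addr ?leqnn //; congr (_ + _).
  apply: eq_big_nat => t ht; rewrite encodeK // roll_code //; lia.
have croll t : (t1 <= t)%N -> continuous (fun U => rollout t1 z w (decode U) t).
  by move=> ht; apply: continuous_cV => i; exact: continuous_rollout.
have ccomp m (F : 'cV[R]_m -> R) (y : 'rV[R]_(N * udim P) -> 'cV[R]_m) :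
    continuous F -> continuous y -> continuous (fun U => F (y U)).
  by move=> cF cy U; apply: continuous_comp; [exact: cy | exact: cF].
have cJ : continuous (J \o decode).
  have cS : continuous (fun U => stage_cost t1 (t1 + N)
      (rollout t1 z w (decode U)) (decode U)).
    rewrite /stage_cost; under eq_fun do rewrite big_nat_cond.
    apply: continuous_big => [x|t]; first exact: add_continuous.
    rewrite andbT => /andP[ht1 ht2] U.
    have tT : (t < T)%N by apply: leq_trans hN.
    have c1 := @ccomp _ _ _ (cost_continuous (cx t tT)) (croll t ht1).
    have cd : continuous (fun U => decode U t).
      by apply: continuous_cV => i; exact: continuous_decode.
    have c2 := @ccomp _ _ _ (cost_continuous (cu t tT)) cd.
    exact: (continuousD (c1 U) (c2 U)).
  have cF := ccomp _ _ _ cG (croll _ (leq_addr N t1)).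
  by move=> U; exact: (continuousD (cS U) (cF U)).
have coerc U : mu / 2 * dot U^T U^T <= (J \o decode) U.
  rewrite dot_decode mulr_sumr.
  apply: le_trans (@stage_cost_ge t1 _ (rollout t1 z w (decode U)) (decode U) hN) _.
  by rewrite /= /J lerDl.
have mu2 : 0 < mu / 2 by rewrite divr_gt0.
have cCU := ccomp _ _ _ cC (croll _ (leq_addr N t1)).
have Ccode v : C (rollout t1 z w v (t1 + N)) = 0 ->
    C (rollout t1 z w (decode (encode v)) (t1 + N)) = 0.
  by rewrite roll_code // leq_addr leqnn.
have [U CU Umin] := coercive_argmin mu2 cJ cCU coerc (Ccode _ Cv0).
exists (decode U) => // v' Cv'; rewrite -(J_code v').
exact: Umin (Ccode _ Cv').
Qed.

End Existence.

Definition disturbance (xi : params P) (t : nat) : stateT := wdist P t (xi t).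

Lemma feasible_rollout t1 t2 z xi s : feasible t1 t2 z xi s ->
  forall t, (t1 <= t <= t2)%N -> s.1 t = rollout t1 z (disturbance xi) s.2 t.
Proof. by case=> h0 hS; exact: rollout_unique. Qed.

Lemma rollout_feasible t1 t2 z xi v :
  feasible t1 t2 z xi (rollout t1 z (disturbance xi) v, v).
Proof. by split=> [|t /andP[h _]] /=; rewrite ?rollout_init ?rolloutS. Qed.

Lemma ftocp_opt_final t1 z xi s :
  ftocp_opt t1 T z xi (final_cost (P := P)) s <->
  feasible t1 T z xi s /\ forall s', feasible t1 T z xi s' ->
    stage_cost t1 T s.1 s.2 + costT P (s.1 T) <=
    stage_cost t1 T s'.1 s'.2 + costT P (s'.1 T).
Proof.
split=> [[hf _ hmin]|[hf hmin]].
  by split=> // s' /hmin; rewrite /ftocp_cost /final_cost -!EFinD lee_fin.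
by split=> //; rewrite /ftocp_cost /final_cost -?EFinD ?ltry // => s' /hmin;
  rewrite -EFinD lee_fin.
Qed.

Lemma ftocp_opt_indic t1 t2 z xi zeta s :
  ftocp_opt t1 t2 z xi (indic_cost zeta) s <->
  [/\ feasible t1 t2 z xi s, s.1 t2 = zeta &
      forall s', feasible t1 t2 z xi s' -> s'.1 t2 = zeta ->
      stage_cost t1 t2 s.1 s.2 <= stage_cost t1 t2 s'.1 s'.2].
Proof.
rewrite /ftocp_opt /ftocp_cost /indic_cost; split=> [[hf]|[hf hz hmin]].
  have [hz|] := eqVneq; last by rewrite addey // ltxx.
  move=> _ hmin; split=> // s' hf' hz'; have := hmin s' hf'.
  by rewrite hz' eqxx !adde0 lee_fin.
rewrite hz eqxx adde0; split=> //; first exact: ltry.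
move=> s' hf'; have [hz'|_] := eqVneq; last by rewrite addey // leey.
by rewrite adde0 lee_fin hmin.
Qed.

Lemma stage_cost_feasible t1 t2 z xi s : feasible t1 t2 z xi s ->
  stage_cost t1 t2 s.1 s.2
  = stage_cost t1 t2 (rollout t1 z (disturbance xi) s.2) s.2.
Proof.
move=> hf; apply: eq_big_nat => t ht; rewrite (feasible_rollout hf) //; lia.
Qed.

Lemma psi_final_opt t1 z xi : (t1 <= T)%N ->
  ftocp_opt t1 T z xi (final_cost (P := P))
    (psi t1 T z xi (final_cost (P := P))).
Proof.
move=> ht; rewrite /psi; apply: (@xgetPex _ _ [set s | ftocp_opt t1 T z xi _ s]).
have [_ _ [G0 _ _ _]] := costs; have [_ _ cT] := costs.
have hN : (t1 + (T - t1) <= T)%N by lia.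
have [v _] := @optimal_actions_exist t1 (T - t1)%N z (disturbance xi) hN
  (costT P) (fun=> 0) (fun=> 0) (cost_continuous cT) (@cst_continuous _ _ _) G0 erefl.
rewrite /= subnKC // => vmin.
exists (rollout t1 z (disturbance xi) v, v); apply/ftocp_opt_final.
split=> [|s' hf']; first exact: rollout_feasible.
rewrite /= (stage_cost_feasible hf') (feasible_rollout hf' (t := T)) ?ht ?leqnn //.
exact: vmin.
Qed.

Lemma psi_indic_opt d t1 N (z : stateT) (xi : params P) (zeta : stateT) :
  (forall t, (t + d <= T)%N -> 0 < sigma_min (ctrl_matrix P t d)) ->
  (d <= N)%N -> (t1 + N <= T)%N ->
  ftocp_opt t1 (t1 + N) z xi (indic_cost zeta)
    (psi t1 (t1 + N) z xi (indic_cost zeta)).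
Proof.
move=> hd dN hN; rewrite /psi.
apply: (@xgetPex _ _ [set s | ftocp_opt t1 (t1 + N) z xi _ s]).
have [v0 v0z] := steering hd z (disturbance xi) zeta dN hN.
pose C (y : stateT) := dot (y - zeta) (y - zeta).
have cC : continuous C.
  have cc i : continuous (fun y : stateT => (y - zeta) i 0).
    under eq_fun do rewrite mxE.
    move=> y; apply: (continuousD (coord_continuous (i := i) (j := 0) (x := y))).
    exact: cst_continuous.
  apply: continuous_big => [x|i _ y]; first exact: add_continuous.
  by apply: continuousM; exact: cc.
have Cv0 : C (rollout t1 z (disturbance xi) v0 (t1 + N)) = 0.
  by rewrite v0z /C subrr dot0l.
have [v Cv vmin] := @optimal_actions_exist t1 N z (disturbance xi) hN
  (fun=> 0) C v0 (@cst_continuous _ _ _) cC (fun=> lexx 0) Cv0.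
exists (rollout t1 z (disturbance xi) v, v); apply/ftocp_opt_indic; split=> /=.
- exact: rollout_feasible.
- by apply/eqP; rewrite -subr_eq0; apply/eqP/dot_eq0.
move=> s' hf' hz'; rewrite (stage_cost_feasible hf').
have := vmin s'.2; rewrite /= !addr0; apply.
rewrite -(feasible_rollout hf') ?leq_addr ?leqnn // hz'.
by rewrite /C subrr dot0l.
Qed.

End Optimality.


(** * Stationarity: costates of an optimal trajectory *)

Section Costates.
Context {R : realType} (P : problem R).
Local Notation A := (dynA P).
Local Notation B := (dynB P).
Local Notation T := (horizon P).
Local Notation stateT := 'cV[R]_(xdim P).
Local Notation actionT := 'cV[R]_(udim P).

(** Nothing is said about [p t2]: it is the gradient of the terminal cost if there
    is one, and a free multiplier if the terminal state is prescribed. *)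
Definition kkt (t1 t2 : nat) (w : nat -> stateT) (s : traj P)
    (p : nat -> stateT) : Prop :=
  forall t, (t1 <= t < t2)%N ->
    [/\ s.1 t.+1 = A t *m s.1 t + B t *m s.2 t + w t,
        p t = grad (costx P t) (s.1 t) + (A t)^T *m p t.+1 &
        grad (costu P t) (s.2 t) + (B t)^T *m p t.+1 = 0].

Fixpoint adjoint_steps (t2 : nat) (pT : stateT) (g : nat -> stateT) (j : nat) :=
  if j is i.+1 then
    g (t2 - i.+1)%N + (A (t2 - i.+1)%N)^T *m adjoint_steps t2 pT g i
  else pT.

Definition adjoint t2 pT g t := adjoint_steps t2 pT g (t2 - t).

Lemma adjoint_last t2 pT g : adjoint t2 pT g t2 = pT.
Proof. by rewrite /adjoint subnn. Qed.

Lemma adjoint_rec t2 pT g t : (t < t2)%N ->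
  adjoint t2 pT g t = g t + (A t)^T *m adjoint t2 pT g t.+1.
Proof.
move=> h; rewrite /adjoint; have -> : (t2 - t = (t2 - t.+1).+1)%N by lia.
by rewrite /=; have -> : (t2 - (t2 - t.+1).+1 = t)%N by lia.
Qed.

(** Discrete integration by parts, the telescoping quantity being
    [dot (p t) (eta t)]. *)
Lemma adjoint_by_parts t1 t2 (g p eta : nat -> stateT) (gu nu : nat -> actionT) :
  (t1 <= t2)%N ->
  (forall t, (t1 <= t < t2)%N -> p t = g t + (A t)^T *m p t.+1) ->
  (forall t, (t1 <= t < t2)%N -> eta t.+1 = A t *m eta t + B t *m nu t) ->
  eta t1 = 0 ->
  \sum_(t1 <= t < t2) (dot (g t) (eta t) + dot (gu t) (nu t))
    + dot (p t2) (eta t2)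
  = \sum_(t1 <= t < t2) dot (gu t + (B t)^T *m p t.+1) (nu t).
Proof.
move=> h hp heta eta0.
have : \sum_(t1 <= t < t2)
    (dot (p t.+1) (eta t.+1) - dot (p t) (eta t)) = dot (p t2) (eta t2).
  by rewrite telescope_sumr // eta0 dot0r subr0.
move=> <-; rewrite -big_split; apply: eq_big_nat => t ht /=.
rewrite heta // (hp t) // !dotDl dotDr !(dotC (_^T *m _)) -!dot_mulmx.
by rewrite !(dotC (_ *m _)); ring.
Qed.

Section Necessary.
Variables (mu ell L : R).
Hypotheses (mu_gt0 : 0 < mu) (L_ge0 : 0 <= L) (ell_le : ell <= L).
Hypothesis costs : costs_assumption mu ell P.

(** The terminal gradient [gT] is a parameter because the two terminal conditions
    use [G = costT P] and [G = 0]. *)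
Lemma first_order t1 t2 (y eta : nat -> stateT) (v nu : nat -> actionT)
    (G : stateT -> R) (gT : stateT) : (t2 <= T)%N ->
  (forall s, G (y t2 + s *: eta t2) - G (y t2) - s * dot gT (eta t2)
             <= s ^+ 2 * (L * dot (eta t2) (eta t2))) ->
  (forall s, stage_cost t1 t2 y v + G (y t2) <=
     stage_cost t1 t2 (fun t => y t + s *: eta t) (fun t => v t + s *: nu t)
     + G (y t2 + s *: eta t2)) ->
  \sum_(t1 <= t < t2) (dot (grad (costx P t) (y t)) (eta t)
                       + dot (grad (costu P t) (v t)) (nu t))
    + dot gT (eta t2) = 0.
Proof.
have [cx cu _] := costs; move=> h hG hmin.
pose q := \sum_(t1 <= t < t2) (L * dot (eta t) (eta t) + L * dot (nu t) (nu t))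
  + L * dot (eta t2) (eta t2).
apply: (@linear_part_eq0 _ _ q) => s _.
have hsum : stage_cost t1 t2 (fun t => y t + s *: eta t) (fun t => v t + s *: nu t)
    - stage_cost t1 t2 y v <=
    s * (\sum_(t1 <= t < t2) (dot (grad (costx P t) (y t)) (eta t)
                       + dot (grad (costu P t) (v t)) (nu t)))
    + s ^+ 2 * \sum_(t1 <= t < t2) (L * dot (eta t) (eta t) + L * dot (nu t) (nu t)).
  rewrite /stage_cost -sumrB !mulr_sumr -big_split.
  apply: ler_sum_nat => t /andP[_ tt2] /=.
  have tT : (t < T)%N by apply: leq_trans h.
  have := cost_taylor L_ge0 ell_le (cx t tT) (y t) (s *: eta t).
  have := cost_taylor L_ge0 ell_le (cu t tT) (v t) (s *: nu t).
  rewrite !dotZr !dotZl !ler_norml => /andP[_ h1] /andP[_ h2]; lra.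
have := hG s; have := hmin s; rewrite /q; lra.
Qed.

Lemma feasible_perturb t1 t2 z xi (s : traj P) r nu : (t1 <= t2)%N ->
  feasible t1 t2 z xi s ->
  feasible t1 t2 z xi (fun t => s.1 t + r *: rollout t1 0 (fun=> 0) nu t,
                       fun t => s.2 t + r *: nu t).
Proof.
move=> h [s0 sS]; split=> [|t ht] /=; first by rewrite s0 rollout_init scaler0 addr0.
rewrite sS // rolloutS; last by case/andP: ht.
rewrite addr0 !mulmxDr -!scalemxAr scalerDr.
by rewrite [X in _ = X + _]addrACA [RHS]addrAC.
Qed.

Lemma rollout0S t1 t2 nu t : (t1 <= t < t2)%N ->
  rollout t1 0 (fun=> 0) nu t.+1
  = A t *m rollout t1 0 (fun=> 0) nu t + B t *m nu t.
Proof. by case/andP=> h _; rewrite rolloutS // addr0. Qed.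

(** The adjoint recursion eliminates the state directions, and the reduced gradient
    is then tested against itself. *)
Lemma kkt_final t1 z xi s : (t1 <= T)%N ->
  ftocp_opt t1 T z xi (final_cost (P := P)) s ->
  exists2 p, kkt t1 T (disturbance xi) s p & p T = grad (costT P) (s.1 T).
Proof.
move=> ht /ftocp_opt_final [hf hmin]; have [_ _ cT] := costs.
pose p := adjoint T (grad (costT P) (s.1 T)) (fun t => grad (costx P t) (s.1 t)).
pose h t := grad (costu P t) (s.2 t) + (B t)^T *m p t.+1.
have prec t : (t1 <= t < T)%N -> p t = grad (costx P t) (s.1 t) + (A t)^T *m p t.+1.
  by case/andP=> _ tT; exact: adjoint_rec.
pose eta := rollout t1 0 (fun=> 0) h.
have hsum : \sum_(t1 <= t < T) dot (h t) (h t) = 0.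
  rewrite -(adjoint_by_parts (eta := eta) (fun t => grad (costu P t) (s.2 t)) ht prec
    (@rollout0S _ _ _) (rollout_init _ _ _ _)).
  rewrite /p adjoint_last; apply: (@first_order t1 T s.1 eta s.2 h (costT P)) => // r.
    have := cost_taylor L_ge0 ell_le cT (s.1 T) (r *: eta T).
    rewrite !dotZr !dotZl !ler_norml => /andP[_ h2]; lra.
  exact: hmin _ (feasible_perturb r h ht hf).
exists p; last exact: adjoint_last.
move=> t htT; split; [by case: hf => _; exact | exact: prec |].
apply: dot_eq0.
move/eqP: hsum; rewrite big_nat_cond psumr_eq0; last first.
  by move=> r _; exact: dot_ge0.
by move=> /allP /(_ t); rewrite mem_index_iota htT => /(_ isT) /eqP.
Qed.

(** The linear functional of the actions given by the reduced gradient vanishes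
    on the kernel of the controllability matrix, hence lies in its row space;
    the coefficients are the multiplier of the terminal constraint. *)
Lemma kkt_indic t1 N z xi zeta s : (t1 + N <= T)%N ->
  ftocp_opt t1 (t1 + N) z xi (indic_cost zeta) s ->
  exists p, kkt t1 (t1 + N) (disturbance xi) s p.
Proof.
set t2 := (t1 + N)%N; move=> hN /ftocp_opt_indic [hf hz hmin].
have ht : (t1 <= t2)%N by rewrite leq_addr.
pose q := adjoint t2 0 (fun t => grad (costx P t) (s.1 t)).
pose h t := grad (costu P t) (s.2 t) + (B t)^T *m q t.+1.
have qrec t : (t1 <= t < t2)%N -> q t = grad (costx P t) (s.1 t) + (A t)^T *m q t.+1.
  by case/andP=> _ tT; exact: adjoint_rec.
have stat nu : rollout t1 0 (fun=> 0) nu t2 = 0 ->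
    \sum_(t1 <= t < t2) dot (h t) (nu t) = 0.
  move=> nu0; pose eta := rollout t1 0 (fun=> 0) nu.
  rewrite -(adjoint_by_parts (eta := eta) (fun t => grad (costu P t) (s.2 t)) ht qrec
    (@rollout0S _ _ _) (rollout_init _ _ _ _)).
  rewrite /q adjoint_last.
  apply: (@first_order t1 t2 s.1 eta s.2 nu (fun=> 0)) => // r.
    by rewrite /eta nu0 !dot0r !mulr0 !subr0.
  rewrite !addr0; apply: hmin (feasible_perturb r nu ht hf) _ => /=.
  by rewrite nu0 scaler0 addr0.
pose M := ctrl_matrix P t1 N.
pose X := \mxcol_(j < N) h (t1 + j)%N.
have /submxP[D XD] : (X^T <= M)%MS.
  rewrite submxE; apply/eqP/row_matrixP => i; apply/rowP => k.
  rewrite ord1 row0 [RHS]mxE row_mul row_id mxE.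
  pose c := col k (cokermx M).
  pose nu t : actionT := if insub (t - t1)%N is Some j
    then @submxcol _ N (fun=> udim P) _ c j else 0.
  have cE : \mxcol_(j < N) nu (t1 + j)%N = c.
    by rewrite -[RHS]submxcolK; apply: eq_mxcol => j; rewrite /nu addKn valK.
  have nu0 : rollout t1 0 (fun=> 0) nu t2 = 0.
    by rewrite rollout_ctrl cE -/M /c colE mulmxA mulmx_coker mul0mx.
  have sum0 := stat nu nu0; rewrite sum_nat_shift in sum0; rewrite -[RHS]sum0.
  transitivity ((X^T *m c) 0 0).
    by rewrite mxE; apply: eq_bigr => a _; rewrite !mxE.
  rewrite -cE tr_mxcol mul_mxrow_mxcol summxE; apply: eq_bigr => j _.
  by rewrite mxE; apply: eq_bigr => a _; rewrite !mxE.
pose p t := q t - (transition P t2 t)^T *m D^T.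
exists p => t htT; have [t1t tt2] := andP htT; split.
- by case: hf => _; exact.
- rewrite /p qrec // (transition_split P tt2) trmx_mul mulmxBr mulmxA.
  by rewrite addrA.
have hj : (t - t1 < N)%N by rewrite ltn_subLR.
have -> : grad (costu P t) (s.2 t) + (B t)^T *m p t.+1
    = h t - (transition P t2 t.+1 *m B t)^T *m D^T.
  by rewrite /p /h mulmxBr trmx_mul mulmxA addrA.
have := congr1 trmx XD; rewrite trmxK trmx_mul => XE.
have := congr1 (fun Y => submxcol Y (Ordinal hj)) XE.
rewrite /X mxcolK /M /ctrl_matrix tr_mxrow /= mxcol_mul mxcolK /= subnKC // => ->.
by rewrite subrr.
Qed.

End Necessary.
End Costates.


(** * Difference of two stationary trajectories: bounds on the costate *)

Section NatSums.
Context {R : realType}.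

Lemma ler_sum_subrange (F : nat -> R) (Q : pred nat) a b i r :
  (forall t, (a <= t < b)%N -> 0 <= F t) -> (a <= i)%N -> (r <= b)%N ->
  (forall t, (i <= t < r)%N -> Q t) ->
  \sum_(i <= t < r) F t <= \sum_(a <= t < b | Q t) F t.
Proof.
move=> F0 ai rb hQ.
rewrite (big_nat_widenl _ _ _ _ _ ai) (big_nat_widen _ _ _ _ _ rb).
rewrite [leLHS]big_nat_cond [leRHS]big_nat_cond [leRHS]big_mkcond [leLHS]big_mkcond.
apply: ler_sum => t _; case: ifP => [/andP[h1 /andP[/= h2 h3]]|_].
  by rewrite h1 hQ // h2.
by case: ifP => // /andP[h _]; exact: F0.
Qed.

Lemma sum_near_count (a b d t : nat) :
  \sum_(a <= j < b | (t <= j + d)%N && (j <= t + d)%N) (1 : R)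
  <= (2 * d + 1)%:R.
Proof.
rewrite -(natr_sum R _ _ (fun=> 1%N)) sum1_count -size_filter ler_nat.
have -> : (2 * d + 1 = size (iota (t - d) (t + d + 1 - (t - d))) +
  (2 * d + 1 - (t + d + 1 - (t - d))))%N by rewrite size_iota; lia.
apply: leq_trans (leq_addr _ _).
apply: uniq_leq_size; first by rewrite filter_uniq ?iota_uniq.
by move=> j; rewrite mem_filter mem_iota => /andP[/andP[h1 h2] _]; lia.
Qed.

End NatSums.

Section Sensitivity.
Context {R : realType} (P : problem R).
Local Notation A := (dynA P).
Local Notation B := (dynB P).
Local Notation T := (horizon P).
Local Notation stateT := 'cV[R]_(xdim P).
Local Notation actionT := 'cV[R]_(udim P).
Variables (mu L al be sigma : R) (d : nat).
Hypotheses (mu_gt0 : 0 < mu) (L_ge0 : 0 <= L).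
Hypotheses (sigma_gt0 : 0 < sigma).
Hypothesis A_bound : forall t, (t < T)%N -> forall x : stateT,
  dot ((A t)^T *m x) ((A t)^T *m x) <= al ^+ 2 * dot x x.
Hypothesis B_bound : forall t, (t < T)%N -> forall x : stateT,
  dot ((B t)^T *m x) ((B t)^T *m x) <= be ^+ 2 * dot x x.
Hypothesis ctrl_bound : forall t, (t + d <= T)%N ->
  sigma <= sigma_min (ctrl_matrix P t d).

Lemma dot_ctrl_matrix_tr i k (x : stateT) :
  dot ((ctrl_matrix P i k)^T *m x) ((ctrl_matrix P i k)^T *m x) =
  \sum_(j < k) dot ((transition P (i + k) (i + j).+1 *m B (i + j)%N)^T *m x)
                   ((transition P (i + k) (i + j).+1 *m B (i + j)%N)^T *m x).
Proof.
have dotE m (u v : 'cV[R]_m) : dot u v = (u^T *m v) 0 0.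
  by rewrite mxE; apply: eq_bigr => l _; rewrite mxE.
rewrite dotE /ctrl_matrix tr_mxrow mxcol_mul tr_mxcol mul_mxrow_mxcol summxE.
by apply: eq_bigr => j _; rewrite dotE.
Qed.

(** What remains of two stationary trajectories after subtraction. The dynamics and
    the adjoint equation are linear and pass to the differences; of the nonlinear
    gradients only the differences [gx] and [gu] are kept, with strong monotonicity
    and Lipschitz continuity. *)
Record sensitivity (t1 t2 : nat) (w y : nat -> stateT) (v : nat -> actionT)
    (gx : nat -> stateT) (gu : nat -> actionT) (p : nat -> stateT) : Prop :=
  Sensitivity {
    sens_dyn : forall t, (t1 <= t < t2)%N ->
      y t.+1 = A t *m y t + B t *m v t + w t;
    sens_adj : forall t, (t1 <= t < t2)%N -> p t = gx t + (A t)^T *m p t.+1;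
    sens_stat : forall t, (t1 <= t < t2)%N -> gu t + (B t)^T *m p t.+1 = 0;
    sens_xmono : forall t, (t1 <= t < t2)%N ->
      mu * dot (y t) (y t) <= dot (gx t) (y t);
    sens_umono : forall t, (t1 <= t < t2)%N ->
      mu * dot (v t) (v t) <= dot (gu t) (v t);
    sens_xlip : forall t, (t1 <= t < t2)%N ->
      dot (gx t) (gx t) <= L ^+ 2 * dot (y t) (y t);
    sens_ulip : forall t, (t1 <= t < t2)%N ->
      dot (gu t) (gu t) <= L ^+ 2 * dot (v t) (v t)
  }.

(** Bounds the growth of squares over one step of the recursion
    [x t = gx t + (A t)^T *m x t.+1]. *)
Definition growth : R := 2 * L ^+ 2 + 2 * al ^+ 2 + 1.
Definition window_gain : R :=
  (2 * L ^+ 2 + d%:R * (2 * be ^+ 2 * growth ^+ d)) / sigma ^+ 2.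
Definition costate_gain : R := growth ^+ d * (1 + window_gain + L ^+ 2).

Lemma growth_ge1 : 1 <= growth.
Proof. by rewrite /growth; have := sqr_ge0 L; have := sqr_ge0 al; lra. Qed.

Lemma window_gain_ge0 : 0 <= window_gain.
Proof.
have g0 : 0 <= growth ^+ d by rewrite exprn_ge0 // (le_trans ler01 growth_ge1).
apply: divr_ge0; last exact: sqr_ge0.
apply: addr_ge0; first by rewrite mulr_ge0 ?sqr_ge0.
by do 2![apply: mulr_ge0 => //]; rewrite mulr_ge0 ?sqr_ge0.
Qed.

Lemma costate_gain_ge1 : 1 <= costate_gain.
Proof.
have h1 : 1 <= growth ^+ d by rewrite exprn_ege1 // growth_ge1.
have h2 : 1 <= 1 + window_gain + L ^+ 2.
  by have := window_gain_ge0; have := sqr_ge0 L; lra.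
by rewrite /costate_gain; nra.
Qed.

Section OneSystem.
Variables (t1 t2 : nat) (w y : nat -> stateT) (v : nat -> actionT).
Variables (gx : nat -> stateT) (gu : nat -> actionT) (p : nat -> stateT).
Hypotheses (t2T : (t2 <= T)%N) (t12 : (t1 <= t2)%N).
Hypothesis sys : sensitivity t1 t2 w y v gx gu p.

(** The horizon ends with a state: there is no action at time [t2]. *)
Definition deviation (t : nat) : R :=
  dot (y t) (y t) + (if (t < t2)%N then dot (v t) (v t) else 0).
Local Notation e := deviation.

Lemma deviation_ge0 t : 0 <= e t.
Proof. by rewrite addr_ge0 ?dot_ge0 //; case: ifP => //; rewrite dot_ge0. Qed.

Lemma deviation_y t : dot (y t) (y t) <= e t.
Proof. by rewrite lerDl; case: ifP => //; rewrite dot_ge0. Qed.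

Lemma deviation_v t : (t < t2)%N -> dot (v t) (v t) <= e t.
Proof. by rewrite /deviation => ->; rewrite lerDr dot_ge0. Qed.

(** Stated for any solution [x] of the adjoint recursion: it is applied to the
    costate and, in [costate_window], to the costate minus its homogeneous part. *)
Lemma costate_backward (x : nat -> stateT) j r :
  (t1 <= j)%N -> (j <= r)%N -> (r <= t2)%N ->
  (forall t, (j <= t < r)%N -> x t = gx t + (A t)^T *m x t.+1) ->
  dot (x j) (x j) <= growth ^+ (r - j) *
    (\sum_(j <= t < r) e t + dot (x r) (x r)).
Proof.
move=> t1j jr rt2; rewrite -(subnKC jr); move: (r - j)%N (subnKC jr) => k.
move=> Er; have {rt2 jr r Er} : (j + k <= t2)%N by rewrite Er.
elim: k j t1j => [|k ih] j t1j hk hx.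
  by rewrite addn0 subnn expr0 mul1r big_geq // add0r.
have jt : (t1 <= j < t2)%N by lia.
have xj : x j = gx j + (A j)^T *m x j.+1 by apply: hx; lia.
have -> : (j + k.+1 = j.+1 + k)%N by rewrite addnS addSn.
have := ih j.+1; rewrite !addKn => /(_ (leqW t1j)).
rewrite addSnnS => /(_ hk) h.
have {}h : dot (x j.+1) (x j.+1) <= growth ^+ k *
    (\sum_(j.+1 <= t < j + k.+1) e t + dot (x (j + k.+1)) (x (j + k.+1))).
  by apply: h => t ht; apply: hx; lia.
rewrite (big_ltn (m := j)); last by lia.
have -> : (j + k.+1 - j = k.+1)%N by rewrite addKn.
rewrite exprS; set S := \sum_(_ <= t < _) _ in h *; set X := dot (x (_ + _)%N) _ in h *.
have g1 := growth_ge1.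
have gk : 1 <= growth ^+ k by rewrite exprn_ege1.
have S0 : 0 <= S by apply: sumr_ge0 => t _; exact: deviation_ge0.
have X0 : 0 <= X by exact: dot_ge0.
have := dotDD_le (gx j) ((A j)^T *m x j.+1); rewrite -xj.
have jT : (j < T)%N by clear -jt t2T; lia.
have := A_bound jT (x j.+1); have := sens_xlip sys jt.
have ej := deviation_y j; have e0 := deviation_ge0 j.
move: (dot (x j) (x j)) (dot (gx j) _) (dot (x j.+1) _) h ej (dot (_^T *m _) _)
  (dot_ge0 (y j)) (dot_ge0 (x j.+1)).
move=> xx gg xn h ej ax yy0 xn0 h1 h2 h3.
have hx1 : xx <= growth * (e j + xn).
  rewrite /growth; have := sqr_ge0 L; have := sqr_ge0 al; nra.
apply: le_trans hx1 _; rewrite -mulrA ler_wpM2l //; first by lra.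
nra.
Qed.

(** Controllability makes the costate readable from the actions: up to the state
    terms accumulated on the way, the transposed controllability matrix maps
    [p (i + d)] to minus the vector of the action gradients in the window. *)
Lemma costate_window i : (t1 <= i)%N -> (i + d <= t2)%N ->
  dot (p (i + d)) (p (i + d)) <= window_gain * \sum_(i <= t < i + d) e t.
Proof.
move=> t1i idt2; set r := (i + d)%N; set S := \sum_(_ <= t < _) _.
have idT : (i + d <= T)%N by apply: leq_trans t2T.
have := sigma_min_coercive (ltW sigma_gt0) (ctrl_bound idT) (p r).
rewrite dot_ctrl_matrix_tr -/r.
(* The part of the costate produced by the state gradients inside the window. *)
pose x t := p t - (transition P r t)^T *m p r.
have xrec t : (i <= t < r)%N -> x t = gx t + (A t)^T *m x t.+1.
  move=> /andP[it tr]; rewrite /x (sens_adj sys); last by rewrite /r in tr; lia.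
  by rewrite (transition_split P tr) trmx_mul mulmxBr !mulmxA addrA.
have xr : x r = 0 by rewrite /x transition_id trmx1 mul1mx subrr.
have g1 := growth_ge1.
have S0 a b : 0 <= \sum_(a <= t < b) e t.
  by apply: sumr_ge0 => t _; exact: deviation_ge0.
have xbound t : (i <= t <= r)%N -> dot (x t) (x t) <= growth ^+ d * S.
  move=> /andP[it tr].
  have := @costate_backward x t r (leq_trans t1i it) tr idt2.
  rewrite xr dot0l addr0 => /(_ _) h; apply: le_trans (h _) _.
    by move=> s hs; apply: xrec; lia.
  apply: ler_pM => //; first by rewrite exprn_ge0 // (le_trans ler01).
    by apply: ler_weXn2l => //; rewrite /r; lia.
  apply: le_trans (ler_sum_subrange (Q := xpredT) (a := i) (b := r) _ _ _ _) _ => //.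
  by move=> s _; exact: deviation_ge0.
have term (j : 'I_d) :
    dot ((transition P r (i + j).+1 *m B (i + j)%N)^T *m p r)
        ((transition P r (i + j).+1 *m B (i + j)%N)^T *m p r)
    <= 2 * L ^+ 2 * e (i + j)%N + 2 * be ^+ 2 * growth ^+ d * S.
  have jd := ltn_ord j; have ht : (t1 <= i + j < t2)%N by lia.
  have hT : (i + j < T)%N by lia.
  have -> : (transition P r (i + j).+1 *m B (i + j)%N)^T *m p r
      = - (gu (i + j)%N + (B (i + j)%N)^T *m x (i + j).+1).
    rewrite /x mulmxBr addrA (sens_stat sys ht) sub0r opprK.
    by rewrite trmx_mul mulmxA.
  rewrite dotNl dotNr opprK; apply: le_trans (dotDD_le _ _) _.
  have := B_bound hT (x (i + j).+1); have := sens_ulip sys ht.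
  have hj : (i <= (i + j).+1 <= r)%N by rewrite /r; lia.
  have ev : dot (v (i + j)%N) (v (i + j)%N) <= e (i + j)%N.
    by apply: deviation_v; lia.
  have := xbound _ hj; have := sqr_ge0 L; have := sqr_ge0 be; nra.
move=> h; rewrite -(ler_pM2l (_ : 0 < sigma ^+ 2)) ?exprn_gt0 //.
apply: le_trans h _.
have -> : sigma ^+ 2 * (window_gain * S)
    = (2 * L ^+ 2 + d%:R * (2 * be ^+ 2 * growth ^+ d)) * S.
  by rewrite /window_gain mulrA mulrCA divff ?mulr1 // expf_neq0 // gt_eqF.
apply: le_trans (ler_sum _ (fun j _ => term j)) _.
rewrite big_split /= sumr_const card_ord -mulr_sumr -[_ *+ d]mulr_natl.
by rewrite /S sum_nat_shift; lra.
Qed.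

Definition near_window (j : nat) : R :=
  \sum_(t1 <= t < t2.+1 | (t <= j + d)%N && (j <= t + d)%N) e t.

(** Away from the end of the horizon the costate is controlled by the window
    after it; near the end it is propagated back from the terminal gradient. *)
Lemma costate_near_final j : (t1 <= j <= t2)%N ->
  dot (p t2) (p t2) <= L ^+ 2 * dot (y t2) (y t2) ->
  dot (p j) (p j) <= costate_gain * near_window j.
Proof.
move=> /andP[t1j jt2] hp.
have e0 t (_ : (t1 <= t < t2.+1)%N) := deviation_ge0 t.
have g1 := growth_ge1; have L2 := sqr_ge0 L; have W0 := window_gain_ge0.
have adj_sub r : (r <= t2)%N -> forall t, (j <= t < r)%N ->
    p t = gx t + (A t)^T *m p t.+1.
  by move=> rt2 t ht; apply: (sens_adj sys); lia.
have N0 : 0 <= near_window j.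
  rewrite /near_window big_nat_cond; apply: sumr_ge0 => t /andP[/andP[h1 h2] _].
  exact: deviation_ge0.
have gd1 : 1 <= growth ^+ d by rewrite exprn_ege1.
have [jd|jd] := leqP (j + d) t2.
  have := costate_backward t1j (leq_addr d j) jd (adj_sub _ jd).
  have := costate_window t1j jd; rewrite addKn.
  have hS : \sum_(j <= t < j + d) e t <= near_window j.
    by apply: ler_sum_subrange => //; [exact: leqW | move=> t ht; clear -ht; lia].
  set S := \sum_(_ <= t < _) _ in hS *.
  have S0 : 0 <= S by apply: sumr_ge0 => t _; exact: deviation_ge0.
  rewrite /costate_gain -mulrA; move=> h1 h2; apply: le_trans h2 _.
  by rewrite ler_wpM2l ?(le_trans ler01) //; nra.
have := costate_backward t1j jt2 (leqnn _) (adj_sub _ (leqnn _)).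
have hS : \sum_(j <= t < t2.+1) e t <= near_window j.
  by apply: ler_sum_subrange => //; move=> t ht; clear -ht jd; lia.
rewrite big_nat_recr //= in hS; have := deviation_y t2.
set S := \sum_(_ <= t < _) _ in hS *.
have S0 : 0 <= S by apply: sumr_ge0 => t _; exact: deviation_ge0.
move=> h1 h2; apply: le_trans h2 _; rewrite /costate_gain -mulrA.
have y0 := dot_ge0 (y t2).
apply: ler_pM => //.
- by rewrite exprn_ge0 // (le_trans ler01).
- by rewrite addr_ge0 ?dot_ge0.
- by apply: ler_weXn2l => //; rewrite leq_subLR ltnW.
nra.
Qed.

(** With a fixed terminal state the costate is free at the end, but the horizon
    then contains a full controllability window. *)
Lemma costate_near_fixed j : (t1 <= j <= t2)%N -> (t1 + d <= t2)%N ->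
  dot (p j) (p j) <= costate_gain * near_window j.
Proof.
move=> /andP[t1j jt2] hd.
have e0 t (_ : (t1 <= t < t2.+1)%N) := deviation_ge0 t.
have g1 := growth_ge1; have L2 := sqr_ge0 L; have W0 := window_gain_ge0.
have gd1 : 1 <= growth ^+ d by rewrite exprn_ege1.
have [jd|jd] := leqP (t1 + d) j.
  have := @costate_window (j - d)%N; rewrite subnK; last by lia.
  move=> /(_ _ jt2); have -> : (t1 <= j - d)%N by lia.
  move=> /(_ isT) h; apply: le_trans h _.
  have hS : \sum_(j - d <= t < j) e t <= near_window j.
    apply: ler_sum_subrange => //; [clear -jd; lia | exact: leqW |].
    by move=> t ht; clear -ht; lia.
  have S0 : 0 <= \sum_(j - d <= t < j) e t.
    by apply: sumr_ge0 => t _; exact: deviation_ge0.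
  apply: ler_pM => //; rewrite /costate_gain; nra.
have adj_sub t : (j <= t < t1 + d)%N -> p t = gx t + (A t)^T *m p t.+1.
  by move=> ht; apply: (sens_adj sys); lia.
have := costate_backward t1j (ltnW jd) hd adj_sub.
have := costate_window (leqnn t1) hd.
have hS : \sum_(t1 <= t < t1 + d) e t <= near_window j.
  by apply: ler_sum_subrange => //; [exact: leqW | move=> t ht; clear -ht t1j jd; lia].
have hS' : \sum_(j <= t < t1 + d) e t <= \sum_(t1 <= t < t1 + d) e t.
  apply: (ler_sum_subrange (Q := xpredT)) => // t _; exact: deviation_ge0.
have S0 : 0 <= \sum_(j <= t < t1 + d) e t.
  by apply: sumr_ge0 => t _; exact: deviation_ge0.
move: hS hS' S0; set S := \sum_(t1 <= t < _) _; set S' := \sum_(j <= t < _) _.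
move=> hS hS' S0 h1 h2; apply: le_trans h2 _; rewrite /costate_gain -mulrA.
apply: ler_pM => //.
- by rewrite exprn_ge0 // (le_trans ler01).
- by rewrite addr_ge0 ?dot_ge0.
- by apply: ler_weXn2l => //; rewrite leq_subLR leq_add2r.
nra.
Qed.

End OneSystem.
End Sensitivity.


(** * The weighted energy estimate *)

Section WeightedEnergy.
Context {R : realType} (P : problem R).
Local Notation A := (dynA P).
Local Notation B := (dynB P).
Local Notation stateT := 'cV[R]_(xdim P).
Local Notation actionT := 'cV[R]_(udim P).
Variables (mu L : R) (d t1 t2 : nat) (w y : nat -> stateT) (v : nat -> actionT).
Variables (gx : nat -> stateT) (gu : nat -> actionT) (p : nat -> stateT).
Variables (K eps c : R) (om : nat -> R).
Hypotheses (mu_gt0 : 0 < mu) (d_gt0 : (0 < d)%N) (t12 : (t1 <= t2)%N).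
Hypothesis sys : sensitivity mu L t1 t2 w y v gx gu p.
Hypothesis K_ge1 : 1 <= K.
Local Notation K2 := (2 * (2 * d + 1)%:R * K).
Hypotheses (eps_ge0 : 0 <= eps) (eps_small : 2 * eps * (K2 + 1) <= mu).
Hypothesis om_gt0 : forall t, 0 < om t.
Hypothesis om_slow : forall j t, (t <= j + d)%N -> (j <= t + d)%N ->
  om j <= 2 * om t.
Hypothesis om_step : forall t, `|om t.+1 - om t| <= eps * om t.+1.
Hypothesis costate_near : forall j, (t1 <= j <= t2)%N ->
  dot (p j) (p j) <= K * near_window d t1 t2 y v j.
Hypothesis c_ge0 : 0 <= c.
Hypothesis terminal : mu * dot (y t2) (y t2) <=
  dot (p t2) (y t2) + enorm (p t2) * c + mu * c ^+ 2.

Local Notation e := (deviation t2 y v).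
Let S := \sum_(t1 <= t < t2.+1) om t * e t.
Let Q := \sum_(t1 <= t < t2.+1) om t * dot (p t) (p t).
Let W := \sum_(t1 <= t < t2) om t * dot (w t) (w t).

Lemma young_scalar (h x z : R) : 0 < h -> x * z <= h * x ^+ 2 + z ^+ 2 / (4 * h).
Proof.
move=> h0.
have -> : h * x ^+ 2 + z ^+ 2 / (4 * h) = x * z + (2 * h * x - z) ^+ 2 / (4 * h).
  by field; rewrite gt_eqF.
by rewrite lerDl divr_ge0 ?sqr_ge0 // mulr_ge0 // ltW.
Qed.

(** Every costate is bounded by the deviations at most [d] steps away, over which
    the weight varies by a factor at most [2]; each deviation is counted by at most
    [2 * d + 1] costates. *)
Lemma weighted_costate : Q <= K2 * S.
Proof.
have K0 : 0 <= K by exact: le_trans K_ge1.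
apply: (@le_trans _ _ (\sum_(t1 <= j < t2.+1)
    \sum_(t1 <= t < t2.+1 | (t <= j + d)%N && (j <= t + d)%N)
      2 * K * (om t * e t))).
  apply: ler_sum_nat => j hj.
  have hp := ler_wpM2l (ltW (om_gt0 j)) (costate_near hj).
  apply: le_trans hp _; rewrite /near_window !mulr_sumr.
  apply: ler_sum => t /andP[h1 h2].
  have := om_slow h1 h2; have := deviation_ge0 t2 y v t.
  set x := e t => x0 h; have := ler_wpM2r (mulr_ge0 K0 x0) h; lra.
rewrite (exchange_big_dep_nat xpredT) //= /S mulr_sumr.
apply: ler_sum => t _.
rewrite (eq_bigr (fun=> 2 * K * (om t * e t) * 1)); last by move=> *; rewrite mulr1.
rewrite -mulr_sumr.
have x0 : 0 <= 2 * K * (om t * e t).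
  by rewrite mulr_ge0 // mulr_ge0 ?deviation_ge0 // ltW.
apply: le_trans (ler_wpM2l x0 (sum_near_count t1 t2.+1 d t)) _; lra.
Qed.

(** By the adjoint and stationarity equations the pairing of costate and state
    differences loses [dot (gx t) (y t) + dot (gu t) (v t)] at each step, up to the
    disturbance; strong monotonicity bounds this loss from below. *)
Lemma pairing_step t : (t1 <= t < t2)%N ->
  mu * e t <= dot (p t) (y t) - dot (p t.+1) (y t.+1) + dot (p t.+1) (w t).
Proof.
move=> ht; have tt2 : (t < t2)%N by case/andP: ht.
rewrite /deviation tt2 (sens_dyn sys ht) {1}(sens_adj sys ht).
have := sens_xmono sys ht; have := sens_umono sys ht.
have -> : dot (gu t) (v t) = - dot (p t.+1) (B t *m v t).
  rewrite (dotC (p _)) dot_mulmx dotC -dotNr; congr (dot _ _).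
  by apply/eqP; rewrite -subr_eq0 opprK (sens_stat sys ht).
rewrite !dotDr dotDl (dotC (_^T *m _)) -dot_mulmx (dotC (A t *m _)); lra.
Qed.

(** Multiply [pairing_step] by the weights and sum by parts. The variation of the
    weights costs a factor [eps] and the cross terms are split by Young's
    inequality with parameter [h]; [weighted_costate] turns every costate into
    energy, and both parameters are small enough for the left side to absorb
    it. *)
Lemma weighted_energy :
  S <= (8 * K2 / mu ^+ 2 + 2) *
       (om t1 * dot (y t1) (y t1) + W + om t2 * c ^+ 2).
Proof.
have K20 : 0 < K2.
  have n0 : 0 < (2 * d + 1)%:R :> R by rewrite ltr0n addn1.
  by rewrite pmulr_rgt0 ?mulr_gt0 //; exact: lt_le_trans K_ge1.
pose h := mu / (16 * K2).
have h0 : 0 < h by apply: divr_gt0 => //; apply: mulr_gt0.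
have hQ := weighted_costate.
pose F t := om t * dot (p t) (y t).
have Fstep t : (t1 <= t < t2)%N ->
    mu * (om t * e t) <= (F t - F t.+1) + om t * dot (w t) (w t) / (4 * h)
      + ((2 * h + eps / 2) * (om t.+1 * dot (p t.+1) (p t.+1))
         + eps / 2 * (om t.+1 * e t.+1)).
  move=> ht; have := ler_wpM2l (ltW (om_gt0 t)) (pairing_step ht).
  have o0 := om_gt0 t; have o1 := om_gt0 t.+1.
  have oo : om t <= 2 * om t.+1.
    by apply: om_slow; [rewrite -addn1 leq_add2l | rewrite addSn leqW ?leq_addr].
  have yw := dot_young (p t.+1) (w t) h0.
  have y1 : `|dot (p t.+1) (y t.+1)| <=
      (dot (p t.+1) (p t.+1) + e t.+1) / 2.
    have := deviation_y t2 y v t.+1.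
    have := dot_ge0 (p t.+1 - y t.+1); have := dot_ge0 (p t.+1 + y t.+1).
    rewrite !dotDl !dotDr !dotNl !dotNr (dotC (y _) (p _)) ler_norml.
    by move=> h1 h2 h3; apply/andP; split; lra.
  have cross : (om t.+1 - om t) * dot (p t.+1) (y t.+1) <=
      eps * om t.+1 * ((dot (p t.+1) (p t.+1) + e t.+1) / 2).
    apply: le_trans (ler_norm _) _; rewrite normrM.
    by apply: ler_pM => //; exact: om_step.
  have young := ler_wpM2l (ltW o0) yw.
  have pp := dot_ge0 (p t.+1).
  have extra : om t * (h * dot (p t.+1) (p t.+1)) <=
      2 * h * (om t.+1 * dot (p t.+1) (p t.+1)).
    have := ler_wpM2r (mulr_ge0 (ltW h0) pp) oo; lra.
  rewrite /F -(mulrA (om t) _ (4 * h)^-1).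
  move: (dot (w t) (w t) / (4 * h)) young => ww young0 step0; lra.
have sumF : \sum_(t1 <= t < t2) (F t - F t.+1) = F t1 - F t2.
  rewrite -[RHS]opprB -telescope_sumr // -sumrN.
  by apply: eq_bigr => t _; rewrite opprB.
pose Q' := \sum_(t1 <= t < t2) om t.+1 * dot (p t.+1) (p t.+1).
pose S' := \sum_(t1 <= t < t2) om t.+1 * e t.+1.
have total : mu * (\sum_(t1 <= t < t2) om t * e t) <= (F t1 - F t2) + W / (4 * h)
    + ((2 * h + eps / 2) * Q' + eps / 2 * S').
  rewrite -sumF /W mulr_suml !mulr_sumr -!big_split /=.
  exact: ler_sum_nat Fstep.
have shiftE (f : nat -> R) : \sum_(t1 <= t < t2.+1) f t
    = f t1 + \sum_(t1 <= t < t2) f t.+1.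
  by rewrite big_ltn // big_add1.
have QE : Q = om t1 * dot (p t1) (p t1) + Q' by exact: shiftE.
have SE : S = om t1 * e t1 + S' by exact: shiftE.
have SE2 : S = \sum_(t1 <= t < t2) om t * e t + om t2 * e t2.
  by rewrite /S big_nat_recr.
have o1 := om_gt0 t1; have o2 := om_gt0 t2.
have e2 : e t2 = dot (y t2) (y t2) by rewrite /deviation ltnn addr0.
have Q2 : om t2 * dot (p t2) (p t2) <= Q.
  rewrite /Q big_nat_recr //= lerDr; apply: sumr_ge0 => t _.
  by rewrite mulr_ge0 ?dot_ge0 // ltW.
have Q'0 : 0 <= Q'.
  by apply: sumr_ge0 => t _; rewrite mulr_ge0 ?dot_ge0 // ltW.
have S0 : 0 <= S.
  by apply: sumr_ge0 => t _; rewrite mulr_ge0 ?deviation_ge0 // ltW.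
have F1 : F t1 <= h * (om t1 * dot (p t1) (p t1))
    + om t1 * dot (y t1) (y t1) / (4 * h).
  have := ler_wpM2l (ltW o1) (dot_young (p t1) (y t1) h0).
  by rewrite /F -(mulrA (om t1) _ (4 * h)^-1); lra.
have F2 : mu * (om t2 * e t2) <= F t2 + h * (om t2 * dot (p t2) (p t2))
    + om t2 * c ^+ 2 / (4 * h) + mu * (om t2 * c ^+ 2).
  have := ler_wpM2l (ltW o2) terminal.
  have := ler_wpM2l (ltW o2) (young_scalar (enorm (p t2)) c h0).
  by rewrite enorm_sqr e2 /F -(mulrA (om t2) _ (4 * h)^-1); lra.
set X := om t1 * dot (y t1) (y t1) + W + om t2 * c ^+ 2.
have X0 : om t2 * c ^+ 2 <= X.
  rewrite lerDr addr_ge0 ?mulr_ge0 ?dot_ge0 // ?(ltW o1) //.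
  by apply: sumr_ge0 => t _; rewrite mulr_ge0 ?dot_ge0 // ltW.
have e10 : 0 <= om t1 * e t1 by rewrite mulr_ge0 ?deviation_ge0 // ltW.
have pp10 : 0 <= om t1 * dot (p t1) (p t1) by rewrite mulr_ge0 ?dot_ge0 // ltW.
have Q'Q : Q' <= Q by rewrite QE lerDr.
have S'S : S' <= S by rewrite SE lerDr.
have key : mu * S <= (4 * h + eps / 2) * Q + eps / 2 * S + X / (4 * h) + mu * X.
  have b1 : (2 * h + eps / 2) * Q' <= (2 * h + eps / 2) * Q.
    by rewrite ler_wpM2l // addr_ge0 ?divr_ge0 // mulr_ge0 // ltW.
  have b2 : eps / 2 * S' <= eps / 2 * S by rewrite ler_wpM2l // divr_ge0.
  have b3 : h * (om t1 * dot (p t1) (p t1)) <= h * Q.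
    by rewrite ler_wpM2l ?(ltW h0) // QE lerDl.
  have b4 : h * (om t2 * dot (p t2) (p t2)) <= h * Q by rewrite ler_wpM2l ?(ltW h0).
  have b5 : mu * (om t2 * c ^+ 2) <= mu * X by rewrite ler_wpM2l // ltW.
  have XE : X / (4 * h) = om t1 * dot (y t1) (y t1) / (4 * h) + W / (4 * h)
      + om t2 * c ^+ 2 / (4 * h) by rewrite /X !mulrDl.
  rewrite XE; move: total F1 F2 b1 b2 b3 b4 b5; rewrite SE2 mulrDr; lra.
have hK2 : h * (16 * K2) = mu by rewrite /h divfK // gt_eqF // mulr_gt0.
have absorb : (4 * h + eps / 2) * Q + eps / 2 * S <= mu / 2 * S.
  have c0 : 0 <= 4 * h + eps / 2 by rewrite addr_ge0 ?divr_ge0 // mulr_ge0 // ltW.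
  have := ler_wpM2l c0 hQ; have := ler_wpM2r S0 eps_small; nra.
have -> : 8 * K2 / mu ^+ 2 + 2 = 2 / mu * ((4 * h)^-1 + mu).
  rewrite /h; move: K2 K20 => k2 k20.
  by field; rewrite (gt_eqF k20) (gt_eqF mu_gt0).
have half : mu / 2 * S <= ((4 * h)^-1 + mu) * X by rewrite mulrDl (mulrC _^-1); lra.
have := ler_wpM2l (ltW (divr_gt0 (ltr0n R 2) mu_gt0)) half.
have -> : 2 / mu * (mu / 2 * S) = S by field; rewrite gt_eqF.
by rewrite mulrA.
Qed.

End WeightedEnergy.


(** * The decay rate and the decay of perturbations *)

Section Constants.
Context {R : realType}.
Variables (mu ell sigma a b : R) (d : nat).

Definition lip_const : R := `|ell| + 1.
Definition energy_gain : R :=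
  costate_gain lip_const (`|a| + 1) (`|b| + 1) sigma d.
Definition weighted_gain : R := 2 * (2 * d + 1)%:R * energy_gain.
Definition weight_step : R := mu / (2 * (weighted_gain + 1)).
(** The distance to [1] is small enough for the powers over [d] consecutive steps to
    stay within a factor [2] of each other and for one step to change them by a
    fraction [weight_step] at most. *)
Definition decay_sqr : R := 1 - weight_step / (2 * d.+1%:R * (1 + weight_step)).
Definition decay_rate : R := Num.sqrt decay_sqr.
Definition energy_const : R := 8 * weighted_gain / mu ^+ 2 + 2.

Hypotheses (mu_gt0 : 0 < mu).

Lemma weighted_gain_gt0 : 0 < weighted_gain.
Proof.
have n0 : 0 < (2 * d + 1)%:R :> R by rewrite ltr0n addn1.
apply: mulr_gt0; first exact: mulr_gt0.
by apply: (lt_le_trans ltr01); exact: costate_gain_ge1.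
Qed.

Lemma weight_step_gt0 : 0 < weight_step.
Proof.
by rewrite divr_gt0 // mulr_gt0 // addr_gt0 // weighted_gain_gt0.
Qed.

Let del := weight_step / (2 * d.+1%:R * (1 + weight_step)).

Lemma decay_gap : [/\ 0 < del, 2 * del <= weight_step & 2 * (d.+1%:R * del) <= 1].
Proof.
have e0 := weight_step_gt0; have n1 : 1 <= d.+1%:R :> R by rewrite ler1n.
have e1 : 0 < 1 + weight_step by rewrite addr_gt0.
have den0 : 0 < 2 * d.+1%:R * (1 + weight_step) by rewrite !mulr_gt0.
have E : del * (2 * d.+1%:R * (1 + weight_step)) = weight_step.
  by rewrite /del divfK // gt_eqF.
have d0 : 0 < del by rewrite divr_gt0.
by split=> //; nra.
Qed.

Lemma decay_sqr_bounds : 0 < decay_sqr < 1.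
Proof.
have [d0 d1 d2] := decay_gap; have n1 : 1 <= d.+1%:R :> R by rewrite ler1n.
by rewrite /decay_sqr -/del; apply/andP; split; nra.
Qed.

Lemma decay_rate_sqr : decay_rate ^+ 2 = decay_sqr.
Proof. by rewrite sqr_sqrtr // ltW //; case/andP: decay_sqr_bounds. Qed.

Lemma decay_rate_bounds : 0 < decay_rate < 1.
Proof.
have /andP[r0 r1] := decay_sqr_bounds.
by rewrite sqrtr_gt0 r0 -[ltRHS]sqrtr1 ltr_sqrt.
Qed.

Lemma decay_sqr_pow i : (i <= d)%N -> 2^-1 <= decay_sqr ^+ i.
Proof.
have [d0 d1 d2] := decay_gap; have /andP[r0 r1] := decay_sqr_bounds.
move=> id; have bern : 1 - i%:R * del <= decay_sqr ^+ i.
  elim: i {id} => [|i ih]; first by rewrite mul0r subr0 expr0.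
  rewrite exprS -natr1 {2}/decay_sqr -/del.
  have := ler0n R i; have := ler_wpM2l (ltW r0) ih; rewrite /decay_sqr -/del; nra.
have : i%:R <= d.+1%:R :> R by rewrite ler_nat ltnW.
nra.
Qed.

Definition slow_weight (om : nat -> R) : Prop :=
  [/\ forall t, 0 < om t,
      forall j t, (t <= j + d)%N -> (j <= t + d)%N -> om j <= 2 * om t &
      forall t, `|om t.+1 - om t| <= weight_step * om t.+1].

(** Weights decreasing in time emphasize the initial action: they give the influence
    of later data on it. *)
Lemma slow_weight_forward : slow_weight (fun t => decay_sqr ^+ t).
Proof.
have /andP[r0 r1] := decay_sqr_bounds; have [d0 d1 d2] := decay_gap.
have n1 : 1 <= d.+1%:R :> R by rewrite ler1n.
split=> [t|j t tj jt|t]; first by rewrite exprn_gt0.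
- have [h|/ltnW h] := leqP t j.
    have h1 : decay_sqr ^+ j <= decay_sqr ^+ t by rewrite ler_wiXn2l // ltW.
    have h2 : 0 < decay_sqr ^+ t by rewrite exprn_gt0.
    lra.
  rewrite -(subnKC h) exprD.
  have := @decay_sqr_pow (t - j)%N; rewrite leq_subLR => /(_ tj) h1.
  have := exprn_gt0 j r0; nra.
- have p0 := exprn_gt0 t r0.
  rewrite exprS -{2}[_ ^+ t]mul1r -mulrBl normrM (gtr0_norm p0).
  rewrite distrC gtr0_norm; last by rewrite subr_gt0.
  rewrite [leRHS]mulrA ler_wpM2r ?(ltW p0) //.
  by rewrite /decay_sqr -/del; nra.
Qed.

(** Weights increasing in time give the influence of the initial state on later
    times. *)
Lemma slow_weight_backward : slow_weight (fun t => decay_sqr^-1 ^+ t).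
Proof.
have /andP[r0 r1] := decay_sqr_bounds; have [d0 d1 d2] := decay_gap.
have i0 : 0 < decay_sqr^-1 by rewrite invr_gt0.
have i1 : 1 <= decay_sqr^-1 by rewrite invf_ge1 // ltW.
split=> [t|j t tj jt|t]; first by rewrite exprn_gt0.
- have [h|/ltnW h] := leqP j t.
    have h1 : decay_sqr^-1 ^+ j <= decay_sqr^-1 ^+ t by rewrite ler_weXn2l.
    have h2 : 0 < decay_sqr^-1 ^+ t by rewrite exprn_gt0.
    lra.
  rewrite -(subnKC h) exprD mulrC ler_wpM2r //; first by rewrite ltW // exprn_gt0.
  have := @decay_sqr_pow (j - t)%N; rewrite leq_subLR => /(_ jt) h1.
  by rewrite exprVn invf_ple ?posrE ?exprn_gt0.
- have p0 := exprn_gt0 t i0.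
  rewrite exprS -{2}[_ ^+ t]mul1r -mulrBl normrM (gtr0_norm p0).
  rewrite ger0_norm; last by rewrite subr_ge0.
  rewrite [leRHS]mulrA ler_wpM2r ?(ltW p0) //.
  have E : decay_sqr^-1 * decay_sqr = 1 by rewrite mulVf // gt_eqF.
  by move: E; rewrite {2}/decay_sqr -/del; nra.
Qed.

Lemma energy_const_gt0 : 0 < energy_const.
Proof.
rewrite /energy_const addr_gt0 // divr_gt0 ?exprn_gt0 // mulr_gt0 //.
exact: weighted_gain_gt0.
Qed.

End Constants.

Section Decay.
Context {R : realType} (P : problem R).
Local Notation A := (dynA P).
Local Notation B := (dynB P).
Local Notation T := (horizon P).
Local Notation stateT := 'cV[R]_(xdim P).
Variables (mu ell sigma a b b' : R) (d : nat).
Hypotheses (mu_gt0 : 0 < mu) (sigma_gt0 : 0 < sigma).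
Hypothesis costs : costs_assumption mu ell P.
Hypothesis dyns : dynamics_assumption a b b' sigma d P.
Local Notation L := (lip_const ell).
Local Notation lam := (decay_rate mu ell sigma a b d).
Local Notation rr := (decay_sqr mu ell sigma a b d).
Local Notation C0 := (energy_const mu ell sigma a b d).

Lemma lip_const_ge0 : 0 <= L.
Proof. by rewrite /lip_const; have := normr_ge0 ell; lra. Qed.

Lemma lip_const_ge : ell <= L.
Proof. by rewrite /lip_const; have := ler_norm ell; lra. Qed.

Lemma mulmx_adjoint_bound n m (M : 'M[R]_(n, m)) (c : R) : specnorm M <= c ->
  forall x, dot (M^T *m x) (M^T *m x) <= (`|c| + 1) ^+ 2 * dot x x.
Proof.
move=> hM; apply: dot_mulmx_le => [|x]; first by rewrite addr_ge0.
apply: le_trans (enorm_mulmx_specnorm M x) _; rewrite ler_wpM2r ?enorm_ge0 //.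
by have := ler_norm c; lra.
Qed.

Lemma d_gt0 : (0 < d)%N.
Proof. by case: dyns => _ [/andP[]]. Qed.

Lemma d_le_horizon : (d <= T)%N.
Proof. by case: dyns => _ [/andP[]]. Qed.

Lemma window_controllable t : (t + d <= T)%N -> 0 < sigma_min (ctrl_matrix P t d).
Proof. by case: dyns => _ [_ h _] _; exact: h. Qed.

Lemma cost_grad_lipschitz_sqr n (f : 'cV[R]_n -> R) x y :
  admissible_cost mu ell f ->
  dot (grad f x - grad f y) (grad f x - grad f y) <= L ^+ 2 * dot (x - y) (x - y).
Proof.
have L0 := lip_const_ge0.
move=> hf; rewrite -!enorm_sqr -exprMn ler_pXn2r ?nnegrE ?mulr_ge0 ?enorm_ge0 //.
exact: cost_grad_lipschitz lip_const_ge hf _ _.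
Qed.

Lemma kkt_sensitivity t1 t2 w w' (s s' : traj P) p p' : (t2 <= T)%N ->
  kkt t1 t2 w s p -> kkt t1 t2 w' s' p' ->
  sensitivity mu L t1 t2 (fun t => w t - w' t)
    (fun t => s.1 t - s'.1 t) (fun t => s.2 t - s'.2 t)
    (fun t => grad (costx P t) (s.1 t) - grad (costx P t) (s'.1 t))
    (fun t => grad (costu P t) (s.2 t) - grad (costu P t) (s'.2 t))
    (fun t => p t - p' t).
Proof.
have [cx cu _] := costs; move=> t2T k k'.
have lt_T t : (t1 <= t < t2)%N -> (t < T)%N.
  by move=> /andP[_ h]; apply: leq_trans h t2T.
split=> t ht; have [dyn adj stat] := k t ht; have [dyn' adj' stat'] := k' t ht.
- rewrite dyn dyn' !mulmxBr opprD addrACA; congr (_ + _).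
  by rewrite opprD addrACA.
- by rewrite adj adj' mulmxBr opprD addrACA.
- by rewrite mulmxBr addrACA -opprD stat stat' subrr.
- exact: cost_grad_monotone mu_gt0 lip_const_ge0 lip_const_ge (cx t (lt_T t ht)) _ _.
- exact: cost_grad_monotone mu_gt0 lip_const_ge0 lip_const_ge (cu t (lt_T t ht)) _ _.
- exact: cost_grad_lipschitz_sqr (cx t (lt_T t ht)).
- exact: cost_grad_lipschitz_sqr (cu t (lt_T t ht)).
Qed.

Lemma dynA_bound t : (t < T)%N -> forall x : stateT,
  dot ((A t)^T *m x) ((A t)^T *m x) <= (`|a| + 1) ^+ 2 * dot x x.
Proof. by case: dyns => h _ _ /h [hA _ _]; exact: mulmx_adjoint_bound. Qed.

Lemma dynB_bound t : (t < T)%N -> forall x : stateT,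
  dot ((B t)^T *m x) ((B t)^T *m x) <= (`|b| + 1) ^+ 2 * dot x x.
Proof. by case: dyns => h _ _ /h [_ hB _]; exact: mulmx_adjoint_bound. Qed.

Definition energy (t2 : nat) (s s' : traj P) (t : nat) : R :=
  deviation t2 (fun t => s.1 t - s'.1 t) (fun t => s.2 t - s'.2 t) t.

Lemma energy_x t2 (s s' : traj P) t :
  enorm (s.1 t - s'.1 t) ^+ 2 <= energy t2 s s' t.
Proof. by rewrite enorm_sqr; exact: deviation_y. Qed.

Lemma energy_u t2 (s s' : traj P) t : (t < t2)%N ->
  enorm (s.2 t - s'.2 t) ^+ 2 <= energy t2 s s' t.
Proof.
by rewrite enorm_sqr; exact: (deviation_v (fun t => s.1 t - s'.1 t)
  (fun t => s.2 t - s'.2 t)).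
Qed.

Section TwoSolutions.
Variables (om : nat -> R) (t1 t2 : nat) (w w' : nat -> stateT) (s s' : traj P).
Variables (p p' : nat -> stateT).
Hypotheses (slow : slow_weight mu ell sigma a b d om).
Hypotheses (t12 : (t1 <= t2)%N) (t2T : (t2 <= T)%N).
Hypotheses (k : kkt t1 t2 w s p) (k' : kkt t1 t2 w' s' p').
Let sys := kkt_sensitivity t2T k k'.

Lemma energy_bound (c : R) :
  (forall j, (t1 <= j <= t2)%N -> dot (p j - p' j) (p j - p' j) <=
     energy_gain ell sigma a b d * near_window d t1 t2
       (fun t => s.1 t - s'.1 t) (fun t => s.2 t - s'.2 t) j) ->
  0 <= c ->
  mu * dot (s.1 t2 - s'.1 t2) (s.1 t2 - s'.1 t2) <=
    dot (p t2 - p' t2) (s.1 t2 - s'.1 t2) + enorm (p t2 - p' t2) * c + mu * c ^+ 2 ->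
  \sum_(t1 <= t < t2.+1) om t * energy t2 s s' t <= C0 *
    (om t1 * enorm (s.1 t1 - s'.1 t1) ^+ 2
     + \sum_(t1 <= t < t2) om t * enorm (w t - w' t) ^+ 2 + om t2 * c ^+ 2).
Proof.
have [om0 om_slow om_step] := slow.
move=> hp c0 hc; have K2 := weighted_gain_gt0 ell sigma a b d.
rewrite enorm_sqr; under [X in _ + X + _]eq_bigr do rewrite enorm_sqr.
apply: (weighted_energy mu_gt0 d_gt0 t12 sys _ _ _ om0 om_slow om_step) => //.
- exact: costate_gain_ge1.
- by rewrite ltW // weight_step_gt0.
rewrite -/(weighted_gain ell sigma a b d) /weight_step.
move: (weighted_gain _ _ _ _ _) K2 => g g0.
suff -> : 2 * (mu / (2 * (g + 1))) * (g + 1) = mu by [].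
by field; rewrite gt_eqF // addr_gt0.
Qed.

Lemma energy_final : t2 = T -> p T = grad (costT P) (s.1 T) ->
  p' T = grad (costT P) (s'.1 T) ->
  \sum_(t1 <= t < t2.+1) om t * energy t2 s s' t <= C0 *
    (om t1 * enorm (s.1 t1 - s'.1 t1) ^+ 2
     + \sum_(t1 <= t < t2) om t * enorm (w t - w' t) ^+ 2).
Proof.
move=> tT pT pT'; have [_ _ cT] := costs.
have := @energy_bound 0; rewrite expr0n /= !mulr0 !addr0; apply => //; last first.
  rewrite tT pT pT'.
  exact: cost_grad_monotone mu_gt0 lip_const_ge0 lip_const_ge cT _ _.
move=> j hj; apply: (costate_near_final mu_gt0 lip_const_ge0 sigma_gt0
    dynA_bound dynB_bound _ t2T t12 sys hj); first by case: dyns.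
by rewrite tT pT pT'; exact: cost_grad_lipschitz_sqr.
Qed.

(** The distance between the prescribed terminal states plays the role of a
    disturbance at the terminal time. *)
Lemma energy_fixed : (t1 + d <= t2)%N ->
  \sum_(t1 <= t < t2.+1) om t * energy t2 s s' t <= C0 *
    (om t1 * enorm (s.1 t1 - s'.1 t1) ^+ 2
     + \sum_(t1 <= t < t2) om t * enorm (w t - w' t) ^+ 2
     + om t2 * enorm (s.1 t2 - s'.1 t2) ^+ 2).
Proof.
move=> hd; apply: energy_bound; rewrite ?enorm_ge0 //.
  move=> j hj; apply: (costate_near_fixed mu_gt0 lip_const_ge0 sigma_gt0
    dynA_bound dynB_bound _ t2T t12 sys hj hd); by case: dyns.
rewrite enorm_sqr lerDr.
by have := dot_ge_enorm (p t2 - p' t2) (s.1 t2 - s'.1 t2); lra.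
Qed.

End TwoSolutions.

Local Notation H0 := (Num.sqrt C0).

Lemma energy_term om t1 t2 (s s' : traj P) t : (t1 <= t <= t2)%N ->
  (forall t, 0 < om t) ->
  om t * energy t2 s s' t <= \sum_(t1 <= t < t2.+1) om t * energy t2 s s' t.
Proof.
move=> ht om0; have := @ler_sum_subrange _ (fun t => om t * energy t2 s s' t)
  xpredT t1 t2.+1 t t.+1.
case/andP: ht => ht1 ht2; rewrite big_nat1; apply => //.
by move=> r _; rewrite mulr_ge0 ?deviation_ge0 // ltW.
Qed.

Lemma sum_sqr_le_sqr_sum a1 a2 (f : nat -> R) : (forall t, 0 <= f t) ->
  \sum_(a1 <= t < a2) f t ^+ 2 <= (\sum_(a1 <= t < a2) f t) ^+ 2.
Proof.
move=> f0; elim: (index_iota a1 a2) => [|x r ih]; first by rewrite !big_nil expr0n.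
have S0 : 0 <= \sum_(j <- r) f j by apply: sumr_ge0.
by rewrite !big_cons; have := f0 x; nra.
Qed.

Lemma decay_from_energy (x C z : R) t1 t : (t1 <= t)%N ->
  0 <= x -> 0 <= z -> 0 <= C ->
  rr^-1 ^+ t * x ^+ 2 <= C * (rr^-1 ^+ t1 * z ^+ 2) ->
  x <= Num.sqrt C * lam ^+ (t - t1) * z.
Proof.
move=> t1t x0 z0 C1 h; have /andP[r0 r1] := decay_sqr_bounds ell sigma a b d mu_gt0.
have l0 : 0 <= lam by exact: sqrtr_ge0.
apply: ler_sqr_nneg; first by rewrite !mulr_ge0 ?sqrtr_ge0 ?exprn_ge0.
rewrite !exprMn sqr_sqrtr // exprAC decay_rate_sqr //.
have p0 : 0 < rr ^+ t by rewrite exprn_gt0.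
have := ler_wpM2l (ltW p0) h; rewrite mulrA -exprMn divff ?gt_eqF // expr1n mul1r.
have -> : rr ^+ t = rr ^+ (t - t1) * rr ^+ t1 by rewrite -exprD subnK.
move=> h'; apply: le_trans h' _.
rewrite le_eqVlt; apply/orP; left; apply/eqP.
have : rr ^+ t1 * rr^-1 ^+ t1 = 1 by rewrite -exprMn divff ?gt_eqF // expr1n.
move: (rr ^+ t1) (rr^-1 ^+ t1) => u u' uu'.
transitivity (C * (rr ^+ (t - t1)) * z ^+ 2 * (u * u')); first by ring.
by rewrite uu' mulr1.
Qed.

(** Equal disturbances: the weighted energy is bounded by the initial gap alone, so
    the increasing weights force each later deviation to be small. *)
Lemma decay_initial t1 (w : nat -> stateT) (s s' : traj P) p p' : (t1 <= T)%N ->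
  kkt t1 T w s p -> p T = grad (costT P) (s.1 T) ->
  kkt t1 T w s' p' -> p' T = grad (costT P) (s'.1 T) ->
  (forall t, (t1 <= t <= T)%N -> enorm (s.1 t - s'.1 t) <=
     H0 * lam ^+ (t - t1) * enorm (s.1 t1 - s'.1 t1)) /\
  (forall t, (t1 <= t < T)%N -> enorm (s.2 t - s'.2 t) <=
     H0 * lam ^+ (t - t1) * enorm (s.1 t1 - s'.1 t1)).
Proof.
move=> t1T k pT k' pT'; have slow := slow_weight_backward ell sigma a b d mu_gt0.
have [om0 _ _] := slow.
have := energy_final slow t1T (leqnn T) k k' erefl pT pT'.
rewrite [X in _ + X]big1 ?addr0; last first.
  by move=> t _; rewrite subrr enorm0 expr0n mulr0.
have C1 := ltW (energy_const_gt0 ell sigma a b d mu_gt0).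
move=> hS; split=> t ht; apply: decay_from_energy; rewrite ?enorm_ge0 //.
- by case/andP: ht.
- apply: le_trans hS; apply: le_trans (energy_term _ _ ht om0).
  by rewrite ler_wpM2l ?energy_x // ltW.
- by case/andP: ht.
- have ht' : (t1 <= t <= T)%N by case/andP: ht => h1 h2; rewrite h1 ltnW.
  apply: le_trans hS; apply: le_trans (energy_term _ _ ht' om0).
  by rewrite ler_wpM2l ?energy_u // ?ltW //; case/andP: ht.
Qed.

(** The decreasing weights give a bound in squares;
    [sum_sqr_le_sqr_sum] turns it into the sum of the influences. *)
Lemma decay_first_action t1 t2 (w w' : nat -> stateT) (s s' : traj P) (c : R) :
  (t1 < t2)%N -> 0 <= c ->
  \sum_(t1 <= t < t2.+1) rr ^+ t * energy t2 s s' t <= C0 *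
    (\sum_(t1 <= t < t2) rr ^+ t * enorm (w t - w' t) ^+ 2 + rr ^+ t2 * c ^+ 2) ->
  enorm (s.2 t1 - s'.2 t1) <= H0 *
    (\sum_(t1 <= t < t2) lam ^+ (t - t1) * enorm (w t - w' t) + lam ^+ (t2 - t1) * c).
Proof.
move=> t12 c0 hS; have [om0 _ _] := slow_weight_forward ell sigma a b d mu_gt0.
have C1 := ltW (energy_const_gt0 ell sigma a b d mu_gt0).
have l0 : 0 <= lam by exact: sqrtr_ge0.
pose f t := lam ^+ (t - t1) * enorm (w t - w' t).
have f0 t : 0 <= f t by rewrite mulr_ge0 ?exprn_ge0 ?enorm_ge0.
have lc0 : 0 <= lam ^+ (t2 - t1) * c by rewrite mulr_ge0 ?exprn_ge0.
have Sf0 : 0 <= \sum_(t1 <= t < t2) f t by apply: sumr_ge0.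
have lamE t (x : R) : (t1 <= t)%N ->
    rr ^+ t * x ^+ 2 = rr ^+ t1 * (lam ^+ (t - t1) * x) ^+ 2.
  move=> ht; by rewrite exprMn exprAC decay_rate_sqr // [RHS]mulrA -exprD subnKC.
have ht1 : (t1 <= t1 <= t2)%N by rewrite leqnn ltnW.
have hU := le_trans (energy_term s s' ht1 om0) hS.
have := ler_wpM2l (ltW (om0 t1)) (energy_u s s' t12).
move=> /le_trans /(_ hU).
have -> : \sum_(t1 <= t < t2) rr ^+ t * enorm (w t - w' t) ^+ 2
    = rr ^+ t1 * \sum_(t1 <= t < t2) f t ^+ 2.
  by rewrite mulr_sumr; apply: eq_big_nat => t /andP[ht _]; rewrite lamE.
rewrite (lamE t2) ?(ltnW t12) // -mulrDr (mulrCA C0).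
rewrite (ler_pM2l (om0 t1)) => h.
apply: ler_sqr_nneg; first by rewrite mulr_ge0 ?sqrtr_ge0 // addr_ge0.
rewrite exprMn (sqr_sqrtr C1); apply: le_trans h _; rewrite ler_wpM2l //.
have := sum_sqr_le_sqr_sum t1 t2 f0; nra.
Qed.

End Decay.


(** * Perturbation constants and the length of the prediction horizon *)

Section Perturbation.
Context {R : realType} (P : problem R).
Local Notation B := (dynB P).
Local Notation T := (horizon P).
Local Notation stateT := 'cV[R]_(xdim P).
Local Notation actionT := 'cV[R]_(udim P).
Variables (mu ell sigma a b b' Lw Dw : R) (d : nat).
Hypotheses (mu_gt0 : 0 < mu) (sigma_gt0 : 0 < sigma).
Hypothesis params_ok : well_formed_params P.
Hypothesis costs : costs_assumption mu ell P.
Hypothesis dyns : dynamics_assumption a b b' sigma d P.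
Hypothesis dists : disturbance_assumption Dw Lw P.
Local Notation lam := (decay_rate mu ell sigma a b d).
Local Notation C0 := (energy_const mu ell sigma a b d).
Local Notation H0 := (Num.sqrt C0).

Lemma transition_tr_le t1 r (x : stateT) : (t1 <= r)%N -> (r <= T)%N ->
  dot ((transition P r t1)^T *m x) ((transition P r t1)^T *m x)
  <= ((`|a| + 1) ^+ 2) ^+ (r - t1) * dot x x.
Proof.
move=> h; rewrite -(subnKC h) addKn; move: (r - t1)%N => k {h}.
elim: k x => [|k ih] x hT.
  by rewrite addn0 transition_id trmx1 mul1mx expr0 mul1r.
rewrite addnS in hT *; rewrite transitionS ?leq_addr // trmx_mul -mulmxA.
apply: le_trans (ih _ (ltnW hT)) _; rewrite (exprSr _ k) -mulrA.
by rewrite ler_wpM2l ?exprn_ge0 ?sqr_ge0 // (dynA_bound dyns).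
Qed.

Definition action_gain_lb : R := sigma / (d%:R * (`|a| + 1) ^+ d).

(** An action must be able to move the state: otherwise the controllability
    matrix would be too small. *)
Lemma action_gain_ge (g : R) : 0 <= g ->
  (forall t, (t < T)%N -> forall u : actionT, enorm (B t *m u) <= g * enorm u) ->
  action_gain_lb <= g.
Proof.
move=> g0 hB; have d0 := d_gt0 dyns; have dT := d_le_horizon dyns.
have dT0 : (0 + d <= T)%N by rewrite add0n.
pose x : stateT := const_mx 1.
have x0 : 0 < dot x x.
  rewrite /dot; under eq_bigr do rewrite !mxE mulr1.
  rewrite sumr_const card_ord ltr0n.
  exact: sigma_min_gt0_xdim (window_controllable dyns dT0).
have a1 : 1 <= `|a| + 1 by rewrite lerDr.
have hs : sigma <= sigma_min (ctrl_matrix P 0 d) by case: dyns => _ _; apply.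
have := sigma_min_coercive (ltW sigma_gt0) hs x; rewrite dot_ctrl_matrix_tr => h.
have term (j : 'I_d) :
    dot ((transition P (0 + d) (0 + j).+1 *m B (0 + j)%N)^T *m x)
        ((transition P (0 + d) (0 + j).+1 *m B (0 + j)%N)^T *m x)
    <= g ^+ 2 * (((`|a| + 1) ^+ d) ^+ 2 * dot x x).
  have jd := ltn_ord j; have jT : (0 + j < T)%N by apply: leq_trans dT.
  rewrite trmx_mul -mulmxA; apply: le_trans (dot_mulmx_le g0 (hB _ jT) _) _.
  rewrite ler_wpM2l ?sqr_ge0 //.
  have jd' : ((0 + j).+1 <= 0 + d)%N by [].
  apply: le_trans (transition_tr_le x jd' dT0) _.
  rewrite ler_wpM2r ?dot_ge0 // exprAC ler_pXn2r ?nnegrE ?exprn_ge0 //.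
  by apply: ler_weXn2l => //; rewrite leq_subr.
have {}h := le_trans h (ler_sum _ (fun j _ => term j)).
move: h; rewrite sumr_const card_ord -[_ *+ d]mulr_natl !mulrA ler_pM2r //.
have n1 : 1 <= d%:R :> R by rewrite ler1n.
have ad1 : 1 <= (`|a| + 1) ^+ d by rewrite exprn_ege1.
move=> h; rewrite /action_gain_lb ler_pdivrMr; last first.
  by rewrite mulr_gt0 // (lt_le_trans ltr01).
apply: ler_sqr_nneg; first by rewrite !mulr_ge0 // (le_trans ler01).
apply: le_trans h _; set ad := (`|a| + 1) ^+ d.
have -> : (g * (d%:R * ad)) ^+ 2 = d%:R * (d%:R * g * g * ad * ad) by ring.
by rewrite ler_peMl // !mulr_ge0 // (le_trans ler01).
Qed.

(** The last summand makes every horizon satisfying [horizon_condition] at least as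
    long as the controllability index, see [horizon_ge_index]. *)
Definition perturbation_const : R :=
  1 + H0 * (`|Lw| + 1) + lam^-1 ^+ d / action_gain_lb.
Local Notation H1 := perturbation_const.

Lemma lam_gt0 : 0 < lam.
Proof. by case/andP: (decay_rate_bounds ell sigma a b d mu_gt0). Qed.

Lemma lam_lt1 : lam < 1.
Proof. by case/andP: (decay_rate_bounds ell sigma a b d mu_gt0). Qed.

Lemma action_gain_lb_ge0 : 0 <= action_gain_lb.
Proof.
apply: divr_ge0; first exact: ltW.
by apply: mulr_ge0 => //; rewrite exprn_ge0 // addr_ge0.
Qed.

Lemma perturbation_const_bounds : [/\ 1 <= H1, H0 <= H1, H0 * `|Lw| <= H1 &
  lam^-1 ^+ d / action_gain_lb <= H1].
Proof.
have h1 : 0 <= H0 by exact: sqrtr_ge0.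
have h2 : 0 <= H0 * `|Lw| by rewrite mulr_ge0.
have h3 : 0 <= lam^-1 ^+ d / action_gain_lb.
  by rewrite divr_ge0 ?action_gain_lb_ge0 // exprn_ge0 // invr_ge0 ltW // lam_gt0.
by rewrite /perturbation_const; split; lra.
Qed.

Local Notation q := (fun t : nat => H1 * lam ^+ t).

Lemma disturbance_lipschitz t (xi : params P) : (t < T)%N -> Xi P t (xi t) ->
  enorm (disturbance xi t - disturbance (xi_true P) t)
  <= `|Lw| * enorm (xi t - xi_true P t).
Proof.
move=> tT hxi; have [_ h] := dists tT.
apply: le_trans (h _ _ hxi (params_ok.1 t (ltnW tT))) _.
by rewrite ler_wpM2r ?enorm_ge0 // ler_norm.
Qed.

Lemma action_error_sum t1 t2 (xi : params P) : (t2 <= T)%N ->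
  (forall t, (t1 <= t < t2)%N -> Xi P t (xi t)) ->
  H0 * (\sum_(t1 <= t < t2) lam ^+ (t - t1) *
     enorm (disturbance xi t - disturbance (xi_true P) t))
  <= \sum_(t1 <= t < t2) q (t - t1)%N * enorm (xi t - xi_true P t).
Proof.
move=> t2T hxi; rewrite mulr_sumr; apply: ler_sum_nat => t ht.
have tT : (t < T)%N by case/andP: ht => _ h; apply: leq_trans h t2T.
have lt0 : 0 <= lam ^+ (t - t1) by rewrite exprn_ge0 // ltW // lam_gt0.
have [_ _ hH _] := perturbation_const_bounds.
have x0 := enorm_ge0 (xi t - xi_true P t).
have := ler_wpM2l (mulr_ge0 (sqrtr_ge0 C0) lt0) (disturbance_lipschitz tT (hxi t ht)).
have := ler_wpM2r (mulr_ge0 lt0 x0) hH; lra.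
Qed.

Lemma action_error_fixed t1 t2 (xi : params P) (s s' : traj P) p p' :
  (t1 + d <= t2)%N -> (t2 <= T)%N ->
  kkt t1 t2 (disturbance xi) s p -> kkt t1 t2 (disturbance (xi_true P)) s' p' ->
  s.1 t1 = s'.1 t1 -> (forall t, (t1 <= t < t2)%N -> Xi P t (xi t)) ->
  enorm (s.2 t1 - s'.2 t1) <=
    \sum_(t1 <= t < t2) q (t - t1)%N * enorm (xi t - xi_true P t)
    + q (t2 - t1)%N * enorm (s.1 t2 - s'.1 t2).
Proof.
move=> hd t2T k k' z hxi; have d0 := d_gt0 dyns.
have t12 : (t1 < t2)%N by apply: leq_trans hd; rewrite -addn1 leq_add2l.
have := energy_fixed mu_gt0 sigma_gt0 costs dyns
  (slow_weight_forward ell sigma a b d mu_gt0) (ltnW t12) t2T k k' hd.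
rewrite z subrr enorm0 expr0n mulr0 add0r.
move=> /(decay_first_action mu_gt0 t12 (enorm_ge0 _)) h.
apply: le_trans h _; rewrite mulrDr; apply: lerD.
  exact: action_error_sum.
have [_ hH _ _] := perturbation_const_bounds.
by rewrite mulrA ler_wpM2r ?enorm_ge0 // ler_wpM2r // exprn_ge0 // ltW // lam_gt0.
Qed.

Lemma action_error_final t1 (xi : params P) (s s' : traj P) p p' :
  (t1 < T)%N ->
  kkt t1 T (disturbance xi) s p -> p T = grad (costT P) (s.1 T) ->
  kkt t1 T (disturbance (xi_true P)) s' p' -> p' T = grad (costT P) (s'.1 T) ->
  s.1 t1 = s'.1 t1 -> (forall t, (t1 <= t < T)%N -> Xi P t (xi t)) ->
  enorm (s.2 t1 - s'.2 t1) <=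
    \sum_(t1 <= t < T) q (t - t1)%N * enorm (xi t - xi_true P t).
Proof.
move=> t1T k pT k' pT' z hxi.
have := energy_final mu_gt0 sigma_gt0 costs dyns
  (slow_weight_forward ell sigma a b d mu_gt0) (ltnW t1T) (leqnn T) k k' erefl pT pT'.
rewrite z subrr enorm0 expr0n mulr0 add0r => hS.
have := @decay_first_action _ P _ ell sigma a b d mu_gt0 _ _ (disturbance xi)
  (disturbance (xi_true P)) s s' 0 t1T (lexx _).
rewrite expr0n /= !mulr0 !addr0 => /(_ hS) h.
exact: le_trans h (action_error_sum (leqnn T) hxi).
Qed.

Lemma psi_final_kkt t1 (z : stateT) (xi : params P) : (t1 <= T)%N ->
  let s := psi t1 T z xi (final_cost (P := P)) in
  s.1 t1 = z /\
  exists2 p, kkt t1 T (disturbance xi) s p & p T = grad (costT P) (s.1 T).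
Proof.
move=> ht s.
have os := psi_final_opt mu_gt0 (lip_const_ge0 ell) (lip_const_ge ell) costs z xi ht.
split; first by have [[]] := os.
exact: (kkt_final (lip_const_ge0 ell) (lip_const_ge ell) costs ht os).
Qed.

Lemma psi_indic_kkt t1 k (z zeta : stateT) (xi : params P) :
  (d <= k)%N -> (t1 + k <= T)%N ->
  let s := psi t1 (t1 + k) z xi (indic_cost zeta) in
  [/\ s.1 t1 = z, s.1 (t1 + k)%N = zeta &
      exists p, kkt t1 (t1 + k) (disturbance xi) s p].
Proof.
move=> dk hk s; have c := window_controllable dyns.
have os := psi_indic_opt mu_gt0 (lip_const_ge0 ell) (lip_const_ge ell) costs z xi
  zeta c dk hk.
have kk := kkt_indic (lip_const_ge0 ell) (lip_const_ge ell) costs hk os.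
by move/ftocp_opt_indic: os => [[sz _] szeta _].
Qed.

Lemma perturbation_init_holds : perturbation_init P q.
Proof.
move=> t1 z z' t1T s s'.
have [sz [p k pT]] := psi_final_kkt z (xi_true P) (ltnW t1T).
have [sz' [p' k' pT']] := psi_final_kkt z' (xi_true P) (ltnW t1T).
have [h1 h2] := decay_initial mu_gt0 sigma_gt0 costs dyns (ltnW t1T) k pT k' pT'.
rewrite sz sz' in h1 h2; have [_ hH _ _] := perturbation_const_bounds.
by split=> t ht; [apply: le_trans (h1 t ht) _ | apply: le_trans (h2 t ht) _];
  rewrite ler_wpM2r ?enorm_ge0 // ler_wpM2r // exprn_ge0 // ltW // lam_gt0.
Qed.

Lemma perturbation_params_hold k : (d <= k)%N -> perturbation_params P q k.
Proof.
move=> dk; split.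
  move=> t1 z zeta zeta' xi t1k hxi.
  have [sz szeta [p kk]] := psi_indic_kkt z zeta xi dk (ltnW t1k).
  have [sz' szeta' [p' kk']] := psi_indic_kkt z zeta' (xi_true P) dk (ltnW t1k).
  have := action_error_fixed _ (ltnW t1k) kk kk'; rewrite leq_add2l szeta szeta' addKn.
  by apply => //; rewrite sz sz'.
move=> t1 z xi /andP[_ t1T] hxi.
have [sz [p kk pT]] := psi_final_kkt z xi (ltnW t1T).
have [sz' [p' kk' pT']] := psi_final_kkt z (xi_true P) (ltnW t1T).
have hxi' t : (t1 <= t < T)%N -> Xi P t (xi t).
  by move=> /andP[h1 h2]; apply: hxi; rewrite h1 ltnW.
have zz := etrans sz (esym sz').
apply: le_trans (action_error_final t1T kk pT kk' pT' zz hxi') _.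
rewrite big_nat_recr ?(ltnW t1T) //= lerDl.
have [h1 _ _ _] := perturbation_const_bounds.
apply: mulr_ge0; last exact: enorm_ge0.
apply: mulr_ge0; first exact: le_trans h1.
by rewrite exprn_ge0 // ltW // lam_gt0.
Qed.

Section Horizon.
Variables (Lg : R) (k : nat).
Hypothesis lipB : lipschitz_in_action Lg P.
Hypothesis hk : horizon_condition H1 lam Lg k.

Lemma action_gain_lb_gt0 : 0 < action_gain_lb.
Proof.
apply: divr_gt0 => //; apply: mulr_gt0; first by rewrite ltr0n (d_gt0 dyns).
by rewrite exprn_gt0 // ltr_wpDl.
Qed.

Lemma Lg_ge : action_gain_lb <= Lg.
Proof.
have g0 := action_gain_lb_gt0.
have [Lg0|Lg0] := leP 0 Lg.
  apply: action_gain_ge => // t tT u; have := lipB tT u 0.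
  by rewrite !subr0.
suff : action_gain_lb <= 0 by lra.
apply: action_gain_ge => // t tT u; have := lipB tT u 0; rewrite !subr0 mul0r.
by move=> h; apply: le_trans h _; rewrite nmulr_rle0 ?enorm_ge0.
Qed.

Lemma lam_inv_gt1 : 1 < lam^-1.
Proof. by rewrite invf_gt1 ?lam_gt0 ?lam_lt1. Qed.

Let X := 4 * H1 ^+ 3 * Lg / (1 - lam) ^+ 2.

Lemma horizon_ratio_ge : lam^-1 ^+ d <= X.
Proof.
have g0 := action_gain_lb_gt0; have gL := Lg_ge.
have l0 := lam_gt0; have l1 := lam_lt1.
have [H11 _ _ HL] := perturbation_const_bounds.
have den0 : 0 < (1 - lam) ^+ 2 by rewrite exprn_gt0 // subr_gt0.
have den1 : (1 - lam) ^+ 2 <= 1 by nra.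
have h1 : lam^-1 ^+ d <= H1 * Lg.
  rewrite ler_pdivrMr // in HL; apply: le_trans HL _.
  by rewrite ler_wpM2l // (le_trans ler01).
have H0' : 0 <= H1 * Lg.
  by apply: mulr_ge0; [exact: le_trans H11 | exact: le_trans (ltW g0) gL].
rewrite /X ler_pdivlMr //; apply: (@le_trans _ _ (H1 * Lg)).
  apply: le_trans h1; rewrite ler_piMr // exprn_ge0 // invr_ge0 ltW //.
have -> : 4 * H1 ^+ 3 * Lg = 4 * H1 ^+ 2 * (H1 * Lg) by ring.
by rewrite ler_peMl //; nra.
Qed.

Lemma horizon_ratio_le : X <= lam^-1 ^+ k.
Proof.
have li := lam_inv_gt1; have li0 : 0 < lam^-1 by apply: lt_trans li.
have X0 : 0 < X.
  by apply: lt_le_trans horizon_ratio_ge; rewrite exprn_gt0.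
have lnl : 0 < ln lam^-1 by rewrite ln_gt0.
move: hk; rewrite /horizon_condition -/X ler_pdivrMr // => h.
rewrite -ler_ln ?posrE ?exprn_gt0 // lnXn //.
by rewrite -mulr_natl.
Qed.

(** Hence the problem with a prescribed terminal state is feasible. *)
Lemma horizon_ge_index : (d <= k)%N.
Proof.
have := le_trans horizon_ratio_ge horizon_ratio_le.
by rewrite ler_eXn2l // lam_inv_gt1.
Qed.

Lemma horizon_contraction : 4 * H1 ^+ 3 * Lg * lam ^+ k <= (1 - lam) ^+ 2.
Proof.
have l0 := lam_gt0; have l1 := lam_lt1; have := horizon_ratio_le.
rewrite /X ler_pdivrMr; last by rewrite exprn_gt0 // subr_gt0.
move=> /(ler_wpM2r (ltW (exprn_gt0 k l0))) h; apply: le_trans h _.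
by rewrite mulrAC -exprMn mulVf ?gt_eqF // expr1n mul1r.
Qed.

End Horizon.
End Perturbation.


(** * Sums of squares of exponentially fading memories *)

Section Sequences.

Context {R : realType}.

Fixpoint fading (l : R) (e : nat -> R) (t : nat) : R :=
  if t is s.+1 then l * fading l e s + e s else 0.

Lemma fading_ge0 l e t : 0 <= l -> (forall t, 0 <= e t) -> 0 <= fading l e t.
Proof. by move=> l0 e0; elim: t => //= t ih; rewrite addr_ge0 // mulr_ge0. Qed.

(** By convexity of the square,
    [fading l e t.+1 ^+ 2 <= l * fading l e t ^+ 2 + e t ^+ 2 / (1 - l)]. *)
Lemma fading_sqr_sum l e n : 0 < l < 1 ->
  (1 - l) ^+ 2 * \sum_(0 <= t < n.+1) fading l e t ^+ 2
  <= \sum_(0 <= t < n) e t ^+ 2.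
Proof.
move=> /andP[l0 l1].
suff h : (1 - l) ^+ 2 * \sum_(0 <= t < n.+1) fading l e t ^+ 2
    + (1 - l) * l * fading l e n ^+ 2 <= \sum_(0 <= t < n) e t ^+ 2.
  apply: le_trans h; rewrite lerDl; apply: mulr_ge0; last exact: sqr_ge0.
  by apply: mulr_ge0; [rewrite subr_ge0 ltW | exact: ltW].
elim: n => [|n ih].
  by rewrite big_nat_recr //= !big_geq //= expr0n /= addr0 !mulr0 addr0.
rewrite big_nat_recr //= [leRHS]big_nat_recr //=.
move: ih; set S := \sum_(_ <= _ < _) _; set E := \sum_(_ <= _ < _) _.
move: (fading l e n) (e n) S E => D x S E ih.
have : 0 <= l * ((1 - l) * D - x) ^+ 2 by rewrite mulr_ge0 ?sqr_ge0 // ltW.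
by nra.
Qed.

Lemma weighted_cauchy_schwarz (s x : nat -> R) n : (forall t, 0 <= s t) ->
  (\sum_(0 <= t < n) s t * x t) ^+ 2 <=
  (\sum_(0 <= t < n) s t) * (\sum_(0 <= t < n) s t * x t ^+ 2).
Proof.
move=> s0; elim: n => [|n ih]; first by rewrite !big_geq // expr0n mul0r.
have A0 : 0 <= \sum_(0 <= t < n) s t by apply: sumr_ge0.
have Q0 : 0 <= \sum_(0 <= t < n) s t * x t ^+ 2.
  by apply: sumr_ge0 => t _; rewrite mulr_ge0 ?sqr_ge0.
rewrite !big_nat_recr //=; move: ih A0 Q0 (s0 n) (x n) => + + + + y.
move: (\sum_(_ <= _ < _) s _) (\sum_(_ <= _ < _) s _ * x _)
  (\sum_(_ <= _ < _) s _ * _ ^+ 2) (s n).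
move=> A S Q an ih A0 Q0 an0.
have key : 2 * S * y <= A * y ^+ 2 + Q.
  have [A0'|A0'] := eqVneq A 0.
    suff -> : S = 0 by rewrite mulr0 mul0r addr_ge0 // mulr_ge0 ?sqr_ge0.
    apply/eqP; rewrite -sqrf_eq0 eq_le sqr_ge0 andbT.
    by move: ih; rewrite A0' mul0r.
  have Ap : 0 < A by rewrite lt_neqAle eq_sym A0' A0.
  have : 0 <= A * (A * y ^+ 2 - 2 * S * y + Q).
    have : 0 <= (A * y - S) ^+ 2 by exact: sqr_ge0.
    by nra.
  by rewrite pmulr_rge0 //; lra.
by have := ler_wpM2l an0 key; nra.
Qed.

Lemma geometric_sum_le (l : R) n : 0 <= l -> l < 1 ->
  \sum_(0 <= t < n) l ^+ t <= (1 - l)^-1.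
Proof.
move=> l0 l1; rewrite -[leRHS]mul1r ler_pdivlMr ?subr_gt0 //.
suff -> : (\sum_(0 <= t < n) l ^+ t) * (1 - l) = 1 - l ^+ n.
  by rewrite gerBl exprn_ge0.
elim: n => [|n ih]; first by rewrite big_geq // mul0r expr0 subrr.
by rewrite big_nat_recr //= mulrDl ih exprS; ring.
Qed.

Lemma sum_le_sqrt (x : nat -> R) n : (forall t, 0 <= x t) ->
  \sum_(0 <= t < n) x t <= Num.sqrt (n%:R * \sum_(0 <= t < n) x t ^+ 2).
Proof.
move=> x0; have := @weighted_cauchy_schwarz (fun=> 1) x n (fun=> ler01).
under eq_bigr do rewrite mul1r.
under [X in _ <= _ * X]eq_bigr do rewrite mul1r.
rewrite sumr_const_nat subn0 => h.
have S0 : 0 <= \sum_(0 <= t < n) x t by apply: sumr_ge0.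
by rewrite -[leLHS]ger0_norm // -sqrtr_sqr ler_wsqrtr.
Qed.

End Sequences.


(** * Tracking error and dynamic regret *)

Section Regret.
Context {R : realType} (P : problem R).
Local Notation A := (dynA P).
Local Notation B := (dynB P).
Local Notation T := (horizon P).
Variables (mu ell sigma a b b' Lw Dw Lg Dxs : R) (d : nat).
Hypotheses (mu_gt0 : 0 < mu) (sigma_gt0 : 0 < sigma).
Hypothesis params_ok : well_formed_params P.
Hypothesis costs : costs_assumption mu ell P.
Hypothesis dyns : dynamics_assumption a b b' sigma d P.
Hypothesis dists : disturbance_assumption Dw Lw P.
Hypothesis lipB : lipschitz_in_action Lg P.
Variable opt : traj P.
Hypothesis opt_is_OPT : is_OPT opt.
Hypothesis opt_bounded : forall t, (t <= T)%N -> enorm (opt.1 t) <= Dxs.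
Local Notation L := (lip_const ell).
Local Notation lam := (decay_rate mu ell sigma a b d).
Local Notation rr := (decay_sqr mu ell sigma a b d).
Local Notation C0 := (energy_const mu ell sigma a b d).
Local Notation H0 := (Num.sqrt C0).
Local Notation H1 := (perturbation_const mu ell sigma a b Lw d).
Local Notation q := (fun t : nat => H1 * lam ^+ t).

Lemma kkt_sub t1 t2 t1' t2' w (s : traj P) p : (t1 <= t1')%N -> (t2' <= t2)%N ->
  kkt t1 t2 w s p -> kkt t1' t2' w s p.
Proof.
move=> h1 h2 k t /andP[h3 h4]; apply: k.
by rewrite (leq_trans h1 h3) (leq_trans h4 h2).
Qed.

Lemma opt_kkt : opt.1 0 = x_init P /\
  exists2 p, kkt 0 T (disturbance (xi_true P)) opt p & p T = grad (costT P) (opt.1 T).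
Proof.
split; first by have [[]] := opt_is_OPT.
exact: (kkt_final (lip_const_ge0 ell) (lip_const_ge ell) costs (leq0n T) opt_is_OPT).
Qed.

Definition action_bound : R := Num.sqrt (C0 * (Dxs ^+ 2 + Dw ^+ 2 / (1 - rr))).

(** The zero trajectory is stationary for the problem without disturbance, so
    the energy estimate bounds the size of the optimal actions. *)
Lemma opt_action_bounded t : (t < T)%N -> enorm (opt.2 t) <= action_bound.
Proof.
move=> tT; have [_ [p k pT]] := opt_kkt.
have /andP[r0 r1] := decay_sqr_bounds ell sigma a b d mu_gt0.
have [cx cu cT] := costs; have L0 := lip_const_ge0 ell; have Ll := lip_const_ge ell.
pose zero : traj P := (fun=> 0, fun=> 0).
have kz : kkt t T (fun=> 0) zero (fun=> 0).
  move=> r /andP[_ rT]; rewrite /= !mulmx0 !addr0.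
  by rewrite (cost_grad0 L0 Ll (cx r rT)) (cost_grad0 L0 Ll (cu r rT)).
have zT : 0 = grad (costT P) (zero.1 T) by rewrite (cost_grad0 L0 Ll cT).
have slow := slow_weight_forward ell sigma a b d mu_gt0; have [om0 _ _] := slow.
have kt := kkt_sub (leq0n t) (leqnn T) k.
have hS := energy_final mu_gt0 sigma_gt0 costs dyns slow (ltnW tT) (leqnn T)
  kt kz erefl pT zT.
have ht : (t <= t <= T)%N by rewrite leqnn ltnW.
have hU := le_trans (energy_term opt zero ht om0) hS.
have := ler_wpM2l (ltW (om0 t)) (energy_u opt zero tT).
move=> /le_trans /(_ hU); rewrite /= !subr0 => {hS hU} h.
have Dx2 : enorm (opt.1 t) ^+ 2 <= Dxs ^+ 2.
  have := opt_bounded (ltnW tT); have := enorm_ge0 (opt.1 t); nra.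
have Sw : \sum_(t <= r < T) rr ^+ r * enorm (disturbance (xi_true P) r - 0) ^+ 2
    <= rr ^+ t * (Dw ^+ 2 / (1 - rr)).
  apply: (@le_trans _ _ (Dw ^+ 2 * \sum_(t <= r < T) rr ^+ r)).
    rewrite mulr_sumr; apply: ler_sum_nat => r /andP[_ rT].
    rewrite mulrC ler_wpM2r ?(ltW (om0 r)) // subr0.
    have := (dists rT).1 _ (params_ok.1 r (ltnW rT)).
    have := enorm_ge0 (disturbance (xi_true P) r); rewrite /disturbance; nra.
  rewrite (mulrCA _ (Dw ^+ 2)) ler_wpM2l ?sqr_ge0 //.
  rewrite -[in X in X <= _](subnKC (ltnW tT)) sum_nat_shift.
  under eq_bigr do rewrite exprD.
  rewrite -mulr_sumr ler_wpM2l ?(ltW (om0 t)) //.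
  by rewrite -(big_mkord xpredT (fun j => rr ^+ j)) geometric_sum_le // ltW.
have C1 := ltW (energy_const_gt0 ell sigma a b d mu_gt0).
have q0 : 0 <= Dw ^+ 2 / (1 - rr) by rewrite divr_ge0 ?sqr_ge0 // subr_ge0 ltW.
rewrite /action_bound -[leLHS]ger0_norm ?enorm_ge0 // -sqrtr_sqr ler_wsqrtr //.
rewrite -(ler_pM2l (om0 t)); apply: le_trans h _.
rewrite (mulrCA _ C0) ler_wpM2l // mulrDr lerD //.
by rewrite ler_wpM2l // ltW.
Qed.

Section Controller.
Variables (k : nat) (pred : nat -> params P).
Hypothesis k_range : (1 <= k <= T)%N.
Hypothesis hk : horizon_condition H1 lam Lg k.
Hypothesis pred_ok : admissible_pred k pred.

Local Notation x := (mpc_state k pred).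
Local Notation u := (fun t => mpc_action k pred t (x t)).

(** The reference for the error of one step: the controller would follow it if it
    knew the true parameters over the whole horizon. *)
Definition continuation (t : nat) : traj P :=
  psi t T (x t) (xi_true P) (final_cost (P := P)).
Local Notation Y := continuation.

Definition action_error (t : nat) : R := enorm (u t - (Y t).2 t).
Local Notation e := action_error.
Local Notation D := (fading lam action_error).

Lemma action_error_ge0 t : 0 <= e t.
Proof. exact: enorm_ge0. Qed.

Lemma continuation_kkt t : (t <= T)%N -> (Y t).1 t = x t /\
  exists2 p, kkt t T (disturbance (xi_true P)) (Y t) p &
    p T = grad (costT P) ((Y t).1 T).
Proof. exact: (psi_final_kkt mu_gt0 costs (x t) (xi_true P)). Qed.

Lemma Lg_gt0 : 0 < Lg.
Proof.
apply: lt_le_trans (Lg_ge sigma_gt0 dyns lipB).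
exact: action_gain_lb_gt0 sigma_gt0 dyns.
Qed.

Lemma one_step_error t : (t < T)%N -> enorm (x t.+1 - (Y t).1 t.+1) <= Lg * e t.
Proof.
move=> tT; have [Yt [p kY _]] := continuation_kkt (ltnW tT).
have ht : (t <= t < T)%N by rewrite leqnn.
have [-> _ _] := kY t ht; rewrite Yt /=.
have -> : A t *m x t + B t *m u t + wdist P t (xi_true P t)
    - (A t *m x t + B t *m (Y t).2 t + disturbance (xi_true P) t)
    = B t *m u t - B t *m (Y t).2 t.
  by rewrite opprD addrACA subrr addr0 opprD addrACA subrr add0r.
by rewrite -mulmxBr; exact: lipB.
Qed.

(** Each step replaces the optimal continuation by one started [Lg * e t] away;
    the effect of this on later times decays at rate [lam]. *)
Lemma tracking t : (t <= T)%N ->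
  (forall r, (t <= r <= T)%N ->
     enorm ((Y t).1 r - opt.1 r) <= H1 * Lg * lam ^+ (r - t) * D t) /\
  (forall r, (t <= r < T)%N ->
     enorm ((Y t).2 r - opt.2 r) <= H1 * Lg * lam ^+ (r - t) * D t).
Proof.
have [_ HH _ _] := perturbation_const_bounds ell a b Lw d mu_gt0 sigma_gt0.
have l0 := lam_gt0 ell sigma a b d mu_gt0.
elim: t => [|t ih] tT.
  have [opt0 [p kp pT]] := opt_kkt.
  have [Y0 [p' kp' pT']] := continuation_kkt (leq0n T).
  have [h1 h2] := decay_initial mu_gt0 sigma_gt0 costs dyns (leq0n T) kp' pT' kp pT.
  rewrite Y0 opt0 /= subrr enorm0 in h1 h2.
  by split=> r hr; [have := h1 r hr | have := h2 r hr]; rewrite /= !mulr0.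
have [ih1 ih2] := ih (ltnW tT).
have [Yt [p kp pT]] := continuation_kkt (ltnW tT).
have [Yt' [p' kp' pT']] := continuation_kkt tT.
have kp1 := kkt_sub (leqnSn t) (leqnn T) kp.
have [h1 h2] := decay_initial mu_gt0 sigma_gt0 costs dyns tT kp' pT' kp1 pT.
rewrite Yt' in h1 h2; have hB := one_step_error tT.
have combine r (X Z : R) : (t < r)%N ->
    X <= H0 * lam ^+ (r - t.+1) * enorm (x t.+1 - (Y t).1 t.+1) ->
    Z <= H1 * Lg * lam ^+ (r - t) * D t ->
    X + Z <= H1 * Lg * lam ^+ (r - t.+1) * D t.+1.
  move=> tr hX hZ.
  have -> : H1 * Lg * lam ^+ (r - t.+1) * D t.+1
      = H1 * lam ^+ (r - t.+1) * (Lg * e t) + H1 * Lg * lam ^+ (r - t) * D t.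
    by rewrite -(subnSK tr) exprS /=; ring.
  apply: lerD hZ; apply: le_trans hX _.
  apply: ler_pM; rewrite ?enorm_ge0 //.
    by rewrite mulr_ge0 ?sqrtr_ge0 // exprn_ge0 // ltW.
  by rewrite ler_wpM2r // exprn_ge0 // ltW.
split=> r hr; apply: le_trans (ler_enorm_dist _ ((Y t).1 r) _) _ ||
  apply: le_trans (ler_enorm_dist _ ((Y t).2 r) _) _.
- by apply: combine (h1 r hr) (ih1 r _); case/andP: hr => // h3 h4; rewrite h4 ltnW.
- by apply: combine (h2 r hr) (ih2 r _); case/andP: hr => // h3 h4; rewrite h4 ltnW.
Qed.

Definition discounted_error (t : nat) : R :=
  \sum_(0 <= r < k) lam ^+ r * pred_error pred t r.
Local Notation Q := discounted_error.

Lemma pred_error_ge0 t r : 0 <= pred_error pred t r.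
Proof. by rewrite /pred_error; case: ifP => // _; exact: enorm_ge0. Qed.

Lemma discounted_errorE t m : (m <= k)%N -> (t + m <= T)%N ->
  \sum_(t <= r < t + m) q (r - t)%N * enorm (pred t r - xi_true P r) <= H1 * Q t.
Proof.
move=> mk tmT; have l0 := lam_gt0 ell sigma a b d mu_gt0.
have [H11 _ _ _] := perturbation_const_bounds ell a b Lw d mu_gt0 sigma_gt0.
rewrite sum_nat_shift /discounted_error.
apply: (@le_trans _ _ (H1 * \sum_(0 <= r < m) lam ^+ r * pred_error pred t r)).
  rewrite big_mkord mulr_sumr; apply: ler_sum => j _ /=.
  rewrite addKn /pred_error (leq_trans _ tmT) ?mulrA // leq_add2l ltnW //.
rewrite ler_wpM2l ?(le_trans ler01) //.
apply: (ler_sum_subrange (Q := xpredT)) => // r _.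
by rewrite mulr_ge0 ?pred_error_ge0 // exprn_ge0 // ltW.
Qed.

(** Far from the end of the horizon the controller plans for the terminal state [0]
    while the continuation passes through some state at time [t + k]; that state is
    within the tracking error of the optimal trajectory, hence the last two
    terms. The horizon condition provides the factor [(1 - lam) / 4]. *)
Lemma action_error_le t : (t < T)%N ->
  e t <= H1 * (Q t + lam ^+ k * Dxs) + (1 - lam) / 4 * D t.
Proof.
move=> tT; have l0 := lam_gt0 ell sigma a b d mu_gt0.
have l1 := lam_lt1 ell sigma a b d mu_gt0.
have [H11 _ _ _] := perturbation_const_bounds ell a b Lw d mu_gt0 sigma_gt0.
have D0 : 0 <= D t by apply: fading_ge0 => [|r]; [exact: ltW | exact: action_error_ge0].
have Dx0 : 0 <= Dxs by apply: le_trans (opt_bounded (leq0n T)); exact: enorm_ge0.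
have lk0 : 0 < lam ^+ k by rewrite exprn_gt0.
have [Yt [p kp pT]] := continuation_kkt (ltnW tT).
have [tkT|Ttk] := ltnP (t + k) T.
  have dk := horizon_ge_index mu_gt0 sigma_gt0 dyns lipB hk.
  have minE : minn (t + k) T = (t + k)%N by apply/minn_idPl/ltnW.
  have [sz sk [p' kp']] := psi_indic_kkt mu_gt0 costs dyns (x t) 0 (pred t) dk (ltnW tkT).
  have kp1 := kkt_sub (leqnn t) (ltnW tkT) kp.
  have hxi r : (t <= r < t + k)%N -> Xi P r (pred t r).
    move=> /andP[h1 h2]; apply: pred_ok; first exact: ltnW.
    by rewrite h1 minE ltnW.
  have zt : (psi t (t + k) (x t) (pred t) (indic_cost 0)).1 t = (Y t).1 t.
    by rewrite sz Yt.
  have tdk : (t + d <= t + k)%N by rewrite leq_add2l.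
  have := action_error_fixed mu_gt0 sigma_gt0 params_ok costs dyns dists
    tdk (ltnW tkT) kp' kp1 zt hxi.
  have -> : (psi t (t + k) (x t) (pred t) (indic_cost 0)).2 t = u t.
    by rewrite /mpc_action /mpc_terminal minE tkT.
  rewrite sk addKn sub0r enormN -/(e t) => h.
  have hQ := discounted_errorE (leqnn k) (ltnW tkT).
  have hY : enorm ((Y t).1 (t + k)%N) <= Dxs + H1 * Lg * lam ^+ k * D t.
    have tk : (t <= t + k <= T)%N by rewrite leq_addr ltnW.
    have := (tracking (ltnW tT)).1 _ tk; rewrite addKn => hY.
    have := ler_enormD ((Y t).1 (t + k)%N - opt.1 (t + k)%N) (opt.1 (t + k)%N).
    rewrite subrK; have := opt_bounded (ltnW tkT); lra.
  have lk1 : lam ^+ k <= 1 by rewrite exprn_ile1 // ltW.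
  have H1lk : 0 <= H1 * lam ^+ k.
    by apply: mulr_ge0; [exact: le_trans H11 | exact: ltW].
  have := ler_wpM2l H1lk hY.
  have contr : H1 * lam ^+ k * (H1 * Lg * lam ^+ k) <= (1 - lam) / 4.
    have := horizon_contraction mu_gt0 sigma_gt0 dyns lipB hk.
    have Lg0 := Lg_gt0.
    have g0 : 0 <= H1 ^+ 2 * Lg * lam ^+ k.
      apply: mulr_ge0; last exact: ltW.
      by apply: mulr_ge0; [exact: sqr_ge0 | exact: ltW].
    have : (1 - lam) ^+ 2 <= 1 - lam by nra.
    have : H1 ^+ 2 * Lg * lam ^+ k * lam ^+ k <= H1 ^+ 2 * Lg * lam ^+ k * H1.
      by rewrite ler_wpM2l // (le_trans lk1).
    lra.
  have := ler_wpM2r D0 contr; lra.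
have minE : minn (t + k) T = T by apply/minn_idPr.
have hxi r : (t <= r < T)%N -> Xi P r (pred t r).
  move=> /andP[h1 h2]; apply: pred_ok; first exact: ltnW.
  by rewrite h1 minE ltnW.
have [sz [p' kp' pT']] := psi_final_kkt mu_gt0 costs (x t) (pred t) (ltnW tT).
have zt : (psi t T (x t) (pred t) (final_cost (P := P))).1 t = (Y t).1 t.
  by rewrite sz Yt.
have := action_error_final mu_gt0 sigma_gt0 params_ok costs dyns dists
  tT kp' pT' kp pT zt hxi.
have -> : (psi t T (x t) (pred t) (final_cost (P := P))).2 t = u t.
  by rewrite /mpc_action /mpc_terminal minE ltnNge Ttk.
rewrite -/(e t) => h.
have := @discounted_errorE t (T - t)%N; rewrite subnKC ?(ltnW tT) // leq_subLR.
move=> /(_ Ttk (leqnn T)) hQ.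
have : 0 <= (1 - lam) / 4 * D t by rewrite mulr_ge0 // divr_ge0 // subr_ge0 ltW.
have : 0 <= H1 * (lam ^+ k * Dxs).
  apply: mulr_ge0; first exact: le_trans H11.
  by apply: mulr_ge0 => //; exact: ltW.
lra.
Qed.

Local Notation E := (\sum_(0 <= r < k) lam ^+ r * pred_power pred r).
Local Notation Z := (E + lam ^+ (2 * k) * T%:R).

Lemma pred_power_ge r : (r < k)%N ->
  \sum_(0 <= t < T) pred_error pred t r ^+ 2 <= pred_power pred r.
Proof.
move=> rk; have rT : (r <= T)%N.
  by apply: leq_trans (ltnW rk) _; case/andP: k_range.
rewrite /pred_power; have F0 t : 0 <= pred_error pred t r ^+ 2 by exact: sqr_ge0.
apply: (@le_trans _ _ (\sum_(0 <= t < T.+1) pred_error pred t r ^+ 2)).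
  by apply: (ler_sum_subrange (Q := xpredT)).
have h : ((T - r).+1 <= T.+1)%N by rewrite ltnS leq_subr.
rewrite (big_cat_nat (leq0n _) h) /= [X in _ + X]big1_seq ?addr0 //.
move=> t; rewrite mem_index_iota => /andP[_ /andP[ht _]].
rewrite /pred_error ifF ?expr0n //; apply/negbTE.
by rewrite -ltnNge addnC -ltn_subLR.
Qed.

Lemma pred_energy_ge0 : 0 <= E.
Proof.
apply: sumr_ge0 => r _; apply: mulr_ge0.
  by rewrite exprn_ge0 // ltW // lam_gt0.
by apply: sumr_ge0 => t _; exact: sqr_ge0.
Qed.

Lemma discounted_error_sqr_sum :
  \sum_(0 <= t < T) Q t ^+ 2 <= E / (1 - lam).
Proof.
have l0 := lam_gt0 ell sigma a b d mu_gt0; have l1 := lam_lt1 ell sigma a b d mu_gt0.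
have lr0 r : 0 <= lam ^+ r by rewrite exprn_ge0 // ltW.
apply: (@le_trans _ _ (\sum_(0 <= t < T)
    (1 - lam)^-1 * \sum_(0 <= r < k) lam ^+ r * pred_error pred t r ^+ 2)).
  apply: ler_sum_nat => t _.
  apply: le_trans (weighted_cauchy_schwarz _ _ lr0) _; rewrite ler_wpM2r //.
    by apply: sumr_ge0 => r _; rewrite mulr_ge0 ?sqr_ge0.
  by rewrite geometric_sum_le // ltW.
rewrite -mulr_sumr mulrC ler_wpM2r ?invr_ge0 ?subr_ge0 ?(ltW l1) //.
rewrite exchange_big_nat /=; apply: ler_sum_nat => r /andP[_ rk].
by rewrite -mulr_sumr ler_wpM2l // pred_power_ge.
Qed.

Definition error_gain : R := 8 * H1 ^+ 2 * ((1 - lam)^-1 + Dxs ^+ 2).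

(** The tracking term in [action_error_le] is itself bounded by the action errors,
    with a factor below [1], and is absorbed. *)
Lemma action_error_sqr_sum : \sum_(0 <= t < T) e t ^+ 2 <= error_gain * Z.
Proof.
have l0 := lam_gt0 ell sigma a b d mu_gt0; have l1 := lam_lt1 ell sigma a b d mu_gt0.
have [H11 _ _ _] := perturbation_const_bounds ell a b Lw d mu_gt0 sigma_gt0.
have l01 : 0 < lam < 1 by rewrite l0 l1.
have term t : (0 <= t < T)%N -> e t ^+ 2 <= 4 * H1 ^+ 2 * Q t ^+ 2
    + 4 * H1 ^+ 2 * (lam ^+ (2 * k) * Dxs ^+ 2) + (1 - lam) ^+ 2 / 8 * D t ^+ 2.
  move=> /andP[_ tT]; have := action_error_le tT; have := action_error_ge0 t.
  rewrite mulnC exprM; move: (e t) (Q t) (D t) (lam ^+ k) => e' Q' D' lk e0 h.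
  set X := H1 * (Q' + lk * Dxs) in h; set W := (1 - lam) / 4 * D' in h.
  have h1 : e' ^+ 2 <= 2 * X ^+ 2 + 2 * W ^+ 2.
    have : e' ^+ 2 <= (X + W) ^+ 2 by nra.
    by have := sqr_ge0 (X - W); lra.
  have h2 : X ^+ 2 <= 2 * H1 ^+ 2 * Q' ^+ 2 + 2 * H1 ^+ 2 * (lk ^+ 2 * Dxs ^+ 2).
    have := mulr_ge0 (sqr_ge0 H1) (sqr_ge0 (Q' - lk * Dxs)).
    by rewrite /X; lra.
  have h3 : 2 * W ^+ 2 = (1 - lam) ^+ 2 / 8 * D' ^+ 2 by rewrite /W; field.
  lra.
have := ler_sum_nat term; rewrite !big_split /= -!mulr_sumr.
rewrite sumr_const_nat subn0 -[_ *+ T]mulr_natl.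
have hQ := ler_wpM2l (sqr_ge0 H1) discounted_error_sqr_sum.
have hD : (1 - lam) ^+ 2 * \sum_(0 <= t < T) D t ^+ 2 <= \sum_(0 <= t < T) e t ^+ 2.
  apply: le_trans (fading_sqr_sum e T l01); rewrite ler_wpM2l ?sqr_ge0 //.
  by rewrite [leRHS]big_nat_recr //= lerDl sqr_ge0.
have E0 := pred_energy_ge0.
have i0 : 0 <= (1 - lam)^-1 by rewrite invr_ge0 subr_ge0 ltW.
have lT0 : 0 <= lam ^+ (2 * k) * T%:R by rewrite mulr_ge0 // exprn_ge0 // ltW.
have c1 := mulr_ge0 (sqr_ge0 H1) (mulr_ge0 i0 lT0).
have c2 := mulr_ge0 (sqr_ge0 H1) (mulr_ge0 (sqr_ge0 Dxs) E0).
have c3 := mulr_ge0 (sqr_ge0 H1) (mulr_ge0 i0 E0).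
have c4 := mulr_ge0 (sqr_ge0 H1) (mulr_ge0 (sqr_ge0 Dxs) lT0).
rewrite /error_gain; move: ((1 - lam)^-1) E i0 E0 hQ c1 c2 c3 c4 => i0' EE _ _.
move: (\sum_(0 <= t < T) e t ^+ 2) (\sum_(0 <= t < T) D t ^+ 2) hD => Se SD hD.
move: (\sum_(0 <= t < T) Q t ^+ 2) => SQ hQ c1 c2 c3 c4 h; lra.
Qed.

Local Notation M := (H1 * Lg).
Local Notation Du := action_bound.

Definition regret_const : R :=
  L * (Dxs + Du) * M * (Num.sqrt (2 * error_gain) / (1 - lam))
  + L * Du * Num.sqrt error_gain
  + (3 * L * M ^+ 2 * (error_gain / (1 - lam) ^+ 2) + 2 * L * error_gain).

Lemma state_gap t : (t <= T)%N -> enorm (x t - opt.1 t) <= M * D t.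
Proof.
move=> tT; have tt : (t <= t <= T)%N by rewrite leqnn.
have := (tracking tT).1 _ tt.
by rewrite subnn expr0 mulr1 (continuation_kkt tT).1.
Qed.

Lemma action_gap t : (t < T)%N -> enorm (u t - opt.2 t) <= e t + M * D t.
Proof.
move=> tT; have tt : (t <= t < T)%N by rewrite leqnn.
have := (tracking (ltnW tT)).2 _ tt; rewrite subnn expr0 mulr1 => h.
apply: le_trans (ler_enorm_dist _ ((Y t).2 t) _) _; exact: lerD.
Qed.

Lemma regret_step (n : nat) (f : 'cV[R]_n -> R) y y' (D0 g : R) :
  admissible_cost mu ell f -> enorm y' <= D0 -> enorm (y - y') <= g ->
  f y - f y' <= L * D0 * g + L * g ^+ 2.
Proof.
move=> hf hy' hg; have L0 := lip_const_ge0 ell.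
have Dp : 0 <= D0 by apply: le_trans hy'; exact: enorm_ge0.
apply: le_trans (cost_diff_le L0 (lip_const_ge ell) hf _ hy') _.
have g0 := enorm_ge0 (y - y').
apply: lerD; first by rewrite ler_wpM2l // mulr_ge0.
by rewrite ler_wpM2l //; nra.
Qed.

(** Optimal states and actions are bounded, so the gradients of the costs along the
    optimal trajectory are: each stage contributes a linear and a quadratic term in
    the gaps. The linear terms are summed by Cauchy-Schwarz, which produces the
    square root. *)
Lemma regret_le : total_cost (mpc_traj k pred) - total_cost opt <=
  regret_const * (Num.sqrt (T%:R * E + lam ^+ (2 * k) * T%:R ^+ 2) + E).
Proof.
have [cx cu cT] := costs; have L0 := lip_const_ge0 ell.
have l0 := lam_gt0 ell sigma a b d mu_gt0; have l1 := lam_lt1 ell sigma a b d mu_gt0.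
have [H11 _ _ _] := perturbation_const_bounds ell a b Lw d mu_gt0 sigma_gt0.
have l01 : 0 < lam < 1 by rewrite l0 l1.
have Dx0 : 0 <= Dxs by apply: le_trans (opt_bounded (leq0n T)); exact: enorm_ge0.
have Du0 : 0 <= Du by exact: sqrtr_ge0.
have M0 : 0 <= M by apply: mulr_ge0; [exact: le_trans H11 | rewrite ltW // Lg_gt0].
have D0 t : 0 <= D t by apply: fading_ge0 => [|r]; [exact: ltW | exact: action_error_ge0].
have E0 := pred_energy_ge0; have T0 : 0 <= T%:R :> R by exact: ler0n.
have T1 : 1 <= T%:R :> R.
  by rewrite ler1n; case/andP: k_range => h1 h2; apply: leq_trans h1 h2.
have lk0 : 0 <= lam ^+ (2 * k) by rewrite exprn_ge0 // ltW.
have Z0 : 0 <= Z by rewrite addr_ge0 // mulr_ge0.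
have gain0 : 0 <= error_gain.
  apply: mulr_ge0; first by rewrite mulr_ge0 ?sqr_ge0.
  by apply: addr_ge0; [rewrite invr_ge0 subr_ge0 ltW | exact: sqr_ge0].
set s := Num.sqrt (T%:R * E + lam ^+ (2 * k) * T%:R ^+ 2).
have TZ : T%:R * Z = T%:R * E + lam ^+ (2 * k) * T%:R ^+ 2 by ring.
have s0 : 0 <= s by exact: sqrtr_ge0.
have Zs : Z <= E + s.
  rewrite lerD2l /s -TZ; apply: ler_sqr_nneg; first exact: sqrtr_ge0.
  rewrite sqr_sqrtr; last exact: mulr_ge0.
  have lk1 : lam ^+ (2 * k) <= 1 by rewrite exprn_ile1 // ltW.
  rewrite TZ; have : 0 <= T%:R * E by rewrite mulr_ge0.
  have : lam ^+ (2 * k) * (lam ^+ (2 * k) * T%:R ^+ 2) <= 1 * (lam ^+ (2 * k) * T%:R ^+ 2).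
    by rewrite ler_wpM2r // mulr_ge0 ?sqr_ge0.
  lra.
have Se := action_error_sqr_sum.
have SD : \sum_(0 <= t < T.+1) D t ^+ 2 <= error_gain * Z / (1 - lam) ^+ 2.
  rewrite ler_pdivlMr ?exprn_gt0 ?subr_gt0 // mulrC.
  exact: le_trans (fading_sqr_sum _ _ l01) Se.
have sum_e : \sum_(0 <= t < T) e t <= Num.sqrt error_gain * s.
  apply: le_trans (sum_le_sqrt _ action_error_ge0) _.
  by rewrite /s -sqrtrM // -TZ ler_wsqrtr // mulrCA ler_wpM2l.
have sum_D : \sum_(0 <= t < T.+1) D t <= Num.sqrt (2 * error_gain) / (1 - lam) * s.
  apply: le_trans (sum_le_sqrt _ D0) _.
  have li0 : 0 <= (1 - lam)^-1 by rewrite invr_ge0 subr_ge0 ltW.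
  have -> : (1 - lam)^-1 = Num.sqrt ((1 - lam)^-1 ^+ 2) by rewrite sqrtr_sqr ger0_norm.
  have g2 : 0 <= 2 * error_gain by apply: mulr_ge0.
  have g3 := mulr_ge0 g2 (sqr_ge0 (1 - lam)^-1).
  rewrite /s -(sqrtrM _ g2) -(sqrtrM _ g3) -TZ ler_wsqrtr //.
  have T2 : T.+1%:R <= 2 * T%:R :> R by rewrite -natr1; lra.
  have S0 : 0 <= \sum_(0 <= t < T.+1) D t ^+ 2 by apply: sumr_ge0 => t _; exact: sqr_ge0.
  apply: le_trans (ler_wpM2r S0 T2) _.
  have := ler_wpM2l (mulr_ge0 (ler0n R 2) T0) SD; rewrite -exprVn; lra.
have step t : (0 <= t < T)%N ->
    costx P t (x t) + costu P t (u t) - (costx P t (opt.1 t) + costu P t (opt.2 t))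
    <= L * (Dxs + Du) * M * D t + 3 * L * M ^+ 2 * D t ^+ 2
       + (L * Du * e t + 2 * L * e t ^+ 2).
  move=> /andP[_ tT].
  have := regret_step (cx t tT) (opt_bounded (ltnW tT)) (state_gap (ltnW tT)).
  have := regret_step (cu t tT) (opt_action_bounded tT) (action_gap tT).
  have := mulr_ge0 L0 (sqr_ge0 (e t - M * D t)); lra.
have last : costT P (x T) - costT P (opt.1 T)
    <= L * (Dxs + Du) * M * D T + 3 * L * M ^+ 2 * D T ^+ 2.
  have := regret_step cT (opt_bounded (leqnn T)) (state_gap (leqnn T)).
  have := mulr_ge0 (mulr_ge0 L0 Du0) (mulr_ge0 M0 (D0 T)).
  have := mulr_ge0 L0 (sqr_ge0 (M * D T)); lra.
have total : total_cost (mpc_traj k pred) - total_cost opt <=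
    L * (Dxs + Du) * M * (\sum_(0 <= t < T.+1) D t)
    + 3 * L * M ^+ 2 * (\sum_(0 <= t < T.+1) D t ^+ 2)
    + (L * Du * (\sum_(0 <= t < T) e t) + 2 * L * \sum_(0 <= t < T) e t ^+ 2).
  rewrite /total_cost /mpc_traj /= opprD addrACA -sumrB.
  rewrite ![\sum_(0 <= t < T.+1) _]big_nat_recr //=.
  have := ler_sum_nat step; rewrite !big_split /= -!mulr_sumr; lra.
apply: le_trans total _; rewrite /regret_const.
have c1 : 0 <= L * (Dxs + Du) * M by do 2![apply: mulr_ge0 => //]; exact: addr_ge0.
have c2 : 0 <= 3 * L * M ^+ 2 by apply: mulr_ge0 (sqr_ge0 _); exact: mulr_ge0.
have c3 : 0 <= L * Du by exact: mulr_ge0.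
have c4 : 0 <= 2 * L by exact: mulr_ge0.
have l2 : 0 <= error_gain / (1 - lam) ^+ 2 by apply: divr_ge0 => //; exact: sqr_ge0.
have := ler_wpM2l c1 sum_D; have := ler_wpM2l c2 SD.
have := ler_wpM2l c3 sum_e; have := ler_wpM2l c4 Se.
have := ler_wpM2l (mulr_ge0 c4 gain0) Zs; have := ler_wpM2l (mulr_ge0 c2 l2) Zs.
have g1 : 0 <= Num.sqrt (2 * error_gain) / (1 - lam).
  by rewrite divr_ge0 ?sqrtr_ge0 // subr_ge0 ltW.
have := mulr_ge0 (mulr_ge0 c1 g1) E0.
have := mulr_ge0 (mulr_ge0 c3 (sqrtr_ge0 error_gain)) E0.
lra.
Qed.

End Controller.
End Regret.

Theorem theorem4p1 (R : realType) (mu ell sigma a b b' Lw : R) (d : nat)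
    (mu_gt0 : 0 < mu) (sigma_gt0 : 0 < sigma) :
  exists H1 lambda1 : R, 1 <= H1 /\ 0 < lambda1 < 1 /\
  forall Lg Dw Dxs : R, exists C : R, 0 < C /\
  forall (P : problem R) (opt : traj P),
    well_formed_params P ->
    costs_assumption mu ell P ->
    dynamics_assumption a b b' sigma d P ->
    disturbance_assumption Dw Lw P ->
    lipschitz_in_action Lg P ->
    is_OPT opt ->
    (forall t, (t <= horizon P)%N -> enorm (opt.1 t) <= Dxs) ->
    let q := fun t : nat => H1 * lambda1 ^+ t in
    perturbation_init P q /\
    forall k : nat, (1 <= k <= horizon P)%N ->
      horizon_condition H1 lambda1 Lg k ->
      perturbation_params P q k /\
      forall pred : nat -> params P, admissible_pred k pred ->
        let E := \sum_(0 <= tau < k) lambda1 ^+ tau * pred_power pred tau in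
        let T := (horizon P)%:R in
        total_cost (mpc_traj k pred) - total_cost opt <=
          C * (Num.sqrt (T * E + lambda1 ^+ (2 * k) * T ^+ 2) + E).
Proof.
exists (perturbation_const mu ell sigma a b Lw d), (decay_rate mu ell sigma a b d).
split; first by case: (perturbation_const_bounds ell a b Lw d mu_gt0 sigma_gt0).
split; first exact: decay_rate_bounds.
move=> Lg Dw Dxs.
pose C := regret_const mu ell sigma a b Lw Dw Lg Dxs d.
exists (`|C| + 1); split; first by rewrite ltr_wpDl.
move=> P opt params_ok costs dyns dists lipB opt_OPT opt_le q.
split; first exact: (perturbation_init_holds Lw mu_gt0 sigma_gt0 costs dyns).
move=> k k_range hk; split.
  apply: (perturbation_params_hold mu_gt0 sigma_gt0 params_ok costs dyns dists).
  exact: (horizon_ge_index mu_gt0 sigma_gt0 dyns lipB hk).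
move=> pred pred_ok; cbv zeta.
apply: le_trans (regret_le mu_gt0 sigma_gt0 params_ok costs dyns dists lipB
  opt_OPT opt_le k_range hk pred_ok) _.
rewrite ler_wpM2r ?addr_ge0 ?sqrtr_ge0 //; last first.
  by apply: le_trans (ler_norm _) _; rewrite lerDl.
exact: (pred_energy_ge0 ell sigma a b d mu_gt0).
Qed.
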